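(* Let $\alpha\ge 2$ and let $\mu$ be a positive Borel measure on $[0,1)$. Then: (i) $\mathcal{H}_{\mu,\alpha}$ is a bounded operator from the Bloch space $\mathscr{B}=\mathscr{B}_1$ into $\mathscr{B}_{\alpha-1}$ if and only if $\mu$ is a $1$-logarithmic $2$-Carleson measure. (ii) $\mathcal{H}_{\mu,\alpha}$ is a compact operator from $\mathscr{B}$ into $\mathscr{B}_{\alpha-1}$ if and only if $\mu$ is a vanishing $1$-logarithmic $2$-Carleson measure.
   Context: $\mathbb{D}$ is the open unit disc, $H(\mathbb{D})$ the analytic functions on $\mathbb{D}$. For $\alpha>0$, the Bloch type space $\mathscr{B}_{\alpha}$ is the set of $f\in H(\mathbb{D})$ with $\|f\|_{\mathscr{B}_\alpha}=\sup_{z\in\mathbb{D}}(1-|z|^2)^{\alpha}|f'(z)|<\infty$; it is a Banach space with norm $|f(0)|+\|f\|_{\mathscr{B}_\alpha}$; $\mathscr{B}=\mathscr{B}_1$. For a positive Borel measure $\mu$ on $[0,1)$ and $\alpha>0$ put $\mu_{n,k,\alpha}=\int_{[0,1)}\frac{\Gamma(n+\alpha)}{n!\,\Gamma(\alpha)}t^{n+k}\,d\mu(t)$ for $n,k\ge 0$, and for $f(z)=\sum_{k\ge0}a_kz^k\in H(\mathbb{D})$ define $\mathcal{H}_{\mu,\alpha}(f)(z)=\sum_{n=0}^\infty\big(\sum_{k=0}^\infty\mu_{n,k,\alpha}a_k\big)z^n$ whenever the right-hand side makes sense (the numbers $\mu_{n,k,\alpha}$ are finite and the inner series converge) and defines an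 analytic function in $\mathbb{D}$. Saying that $\mathcal{H}_{\mu,\alpha}$ is a bounded (or compact) operator from $X$ into $Y$ includes that it is well defined in this sense on every $f\in X$. A positive Borel measure $\mu$ on $[0,1)$ is a $1$-logarithmic $2$-Carleson measure if there is $C>0$ with $\mu([t,1))\log\frac{e}{1-t}\le C(1-t)^2$ for all $0\le t<1$. It is a vanishing $1$-logarithmic $2$-Carleson measure if in addition $\lim_{t\to1^-}\frac{\mu([t,1))\log\frac{e}{1-t}}{(1-t)^2}=0$. *)

(* Defs.v *)
From HB Require Import structures.
From mathcomp Require Import all_boot all_order all_algebra.
From mathcomp Require Import complex.
From mathcomp Require Import all_classical all_reals all_analysis.

Set Implicit Arguments.
Unset Strict Implicit.
Unset Printing Implicit Defensive.

Import Order.TTheory GRing.Theory Num.Theory.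
Import numFieldNormedType.Exports.

Local Open Scope complex_scope.
Local Open Scope ring_scope.
Local Open Scope classical_set_scope.

(* The usual topology of the complex numbers; in particular, for a function
   [f : R[i] -> R[i]], [derive1 f] is the complex derivative. *)
HB.instance Definition _ (R : rcfType) := NormedModule.copy R[i] R[i]^o.

(* The modulus with values in [R]; the norm of [R[i]] takes values in [R[i]]. *)
Notation cmod := (@Normc.normc _).

Section Bloch.
Context {R : realType}.
Implicit Types (f g : R[i] -> R[i]) (a : nat -> R[i]) (b : R) (z : R[i]).

Definition disc : set R[i] := [set z | cmod z < 1].

Definition power_series_at f (c : R[i]) (r : R) a : Prop :=
  forall z, cmod (z - c) < r ->
    series (fun k => a k * (z - c) ^+ k) @ \oo --> f z.

(* Functions on the disc are represented by total functions, whose values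
   outside the disc are never used. *)
Definition analytic_on_disc f : Prop :=
  forall c, disc c -> exists r a, 0 < r /\ power_series_at f c r a.

(* Such a sequence exists and is unique when [f] is analytic on the disc. *)
Definition taylor_coef f : nat -> R[i] :=
  xget (fun=> 0) [set a | power_series_at f 0 1 a].

Definition bloch_seminorm b f : \bar R :=
  ereal_sup [set (((1 - cmod z ^+ 2) `^ b) * cmod (derive1 f z))%:E
            | z in disc].

Definition bloch b : set (R[i] -> R[i]) :=
  [set f | analytic_on_disc f /\ (bloch_seminorm b f < +oo)%E].

Definition bloch_norm b f : \bar R :=
  ((cmod (f 0))%:E + bloch_seminorm b f)%E.

End Bloch.

Section Operators.
Context {R : realType}.
Implicit Types (T : (R[i] -> R[i]) -> R[i] -> R[i])
  (dom : set (R[i] -> R[i])) (b c : R).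

(* [T] is meaningful on the functions in [dom] only. *)
Definition maps_bloch dom T b c : Prop :=
  forall f, bloch b f -> dom f /\ bloch c (T f).

Definition bounded_bloch dom T b c : Prop :=
  maps_bloch dom T b c /\
  exists M : R, forall f, bloch b f ->
    (bloch_norm c (T f) <= M%:E * bloch_norm b f)%E.

Definition compact_bloch dom T b c : Prop :=
  maps_bloch dom T b c /\
  forall F : nat -> R[i] -> R[i],
    (forall n, bloch b (F n)) ->
    (exists M : R, forall n, (bloch_norm b (F n) <= M%:E)%E) ->
    exists (phi : nat -> nat) (g : R[i] -> R[i]),
      [/\ {homo phi : m n / (m < n)%N}, bloch c g &
          bloch_norm c (T (F (phi n)) \- g) @[n --> \oo] --> 0%E].

End Operators.

Section Hankel.
Context {R : realType}.

Definition Gamma (s : R) : R :=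
  (\int[@lebesgue_measure R]_(t in `]0, +oo[) (t `^ (s - 1) * expR (- t)))%R.

(* A Borel measure on [0, 1) is given by a Borel measure [mu] on the real line,
   of which only the restriction to [0, 1) is ever used. *)
Variable mu : {measure set (measurableTypeR R) -> \bar R}.
Variable alpha : R.
Implicit Types (f : R[i] -> R[i]) (n k : nat).

Definition hankel_moment n k : \bar R :=
  (\int[mu]_(t in `[0%R, 1%R[)
     (Gamma (n%:R + alpha) / (n`!%:R * Gamma alpha) * t ^+ (n + k))%:E)%E.

Definition hankel_coef_series f n : nat -> R[i] :=
  series (fun k => (fine (hankel_moment n k))%:C * taylor_coef f k).

Definition hankel_coef f n : R[i] := limn (hankel_coef_series f n).

Definition hankel_series f (z : R[i]) : nat -> R[i] :=
  series (fun n => hankel_coef f n * z ^+ n).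

Definition hankel f (z : R[i]) : R[i] := limn (hankel_series f z).

Definition hankel_dom : set (R[i] -> R[i]) :=
  [set f | [/\ forall n k, hankel_moment n k \is a fin_num,
               forall n, cvgn (hankel_coef_series f n),
               forall z, disc z -> cvgn (hankel_series f z) &
               analytic_on_disc (hankel f)]].

Definition log1_carleson2 : Prop :=
  exists C : R, 0 < C /\ forall t : R, 0 <= t < 1 ->
    (mu `[t, 1%R[ * (ln (expR 1 / (1 - t)))%:E <= (C * (1 - t) ^+ 2)%:E)%E.

Definition vanishing_log1_carleson2 : Prop :=
  log1_carleson2 /\
  (mu `[t, 1%R[ * (ln (expR 1 / (1 - t)) / (1 - t) ^+ 2)%:E)%E
    @[t --> (1 : R)^'-] --> 0%E.

End Hankel.

(* Main.v *)
(* Write L(t) = log (e / (1 - t)), g(n) = Gamma (n + alpha) / (n! Gamma alpha)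
   and f = sum a_k z^k.  The n-th coefficient of H f is
   g(n) sum_k a_k int t^(n+k) dmu = g(n) int t^n f(t) dmu(t).

   Sufficiency.  A Bloch function satisfies |f(t)| <= ||f|| L(t) on [0, 1), so the
   n-th coefficient of H f is at most ||f|| g(n) q(n), with q(n) = int t^n L dmu.
   Tonelli's theorem turns the Carleson condition into
   q(n) <= C / ((n + 1) (n + 2)), and then the coefficients of (H f)' are
   dominated by those of a multiple of (1 - z)^-(alpha - 1).  In the vanishing
   case n^2 q(n) tends to 0: the normalized coefficient sequences of the H f_j are
   dominated by one null sequence, hence relatively compact for the sup norm.

   Necessity.  The partial sums F_J of - log (1 - z) have Bloch norm at most 2 and
   nonnegative coefficients.  At a = N / (N + 1), restricting all the sums to
   n, k <= N and the moments to [a, 1), one gets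
     (N + 1)^2 mu [a, 1) sum_(I < k <= N) 1 / k
       <= C (1 - a^2)^(alpha - 1) |(H F_J - H F_I)'(a)|      (I <= N <= J).
   Boundedness is used with I = 0, compactness with I and J in a subsequence
   along which H F_J converges. *)
Require Import Defs.
From HB Require Import structures.
From mathcomp Require Import all_boot all_order all_algebra.
From mathcomp Require Import complex.
From mathcomp Require Import all_classical all_reals all_analysis.
From mathcomp Require Import cyclic separable cyclotomic measurable_realfun.
From mathcomp Require Import ring lra zify.
Set Implicit Arguments.
Unset Strict Implicit.
Unset Printing Implicit Defensive.
Import Order.TTheory GRing.Theory Num.Theory.
Import numFieldNormedType.Exports.
Local Open Scope complex_scope.
Local Open Scope ring_scope.
Local Open Scope classical_set_scope.

(** Sufficiency uses alpha >= 2 in [hankel_weightS]: the weight g(n) / ((n + 1) (n + 2)), shifted by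
    one and multiplied by n + 1, is at most alpha times the n-th coefficient of (1 - z)^-(alpha -
    1). The sup norm of the coefficients divided by this weight therefore controls the target norm.
    The delicate point is the exchange of sum_k a_k with the integral, because the coefficients of a
    Bloch function are only known to be bounded. The Carleson condition makes the moments summable,
    that is, 1 / (1 - t) integrable, and this controls the truncation error. Complex quantities are
    first rotated by a phase and replaced by their real parts, so that only real functions are
    integrated. In the necessity part, a = N / (N + 1) gives a^(3N) >= e^-3 and 1 - a = 1 / (N + 1).
    The sum of n g(n) over n <= N has order (N + 1)^(alpha + 1), which the Bloch weight (1 -
    a^2)^(alpha - 1) reduces to (N + 1)^2; the harmonic sum supplies L. Subtracting H F_I with I
    fixed costs at most half of the logarithm once N + 1 >= e (I + 1)^2. *)

Local Notation Re := (@complex.Re _).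
Local Notation Im := (@complex.Im _).

(** * Complex sequences and series *)

Section cmod_theory.
Context {R : realType}.
Implicit Types (z w : R[i]).

Lemma cmodE z : `|z| = (cmod z)%:C.
Proof. by rewrite normc_def; case: z. Qed.

Lemma cmod_ge0 z : 0 <= cmod z.
Proof. by case: z => a b; apply: sqrtr_ge0. Qed.

Lemma cmodD z w : cmod (z + w) <= cmod z + cmod w.
Proof. exact: le_normcD. Qed.

Lemma cmodN z : cmod (- z) = cmod z.
Proof. exact: normcN. Qed.

Lemma cmodB z w : cmod (z - w) <= cmod z + cmod w.
Proof. by rewrite (le_trans (cmodD _ _))// cmodN. Qed.

Lemma cmod_distC z w : cmod (z - w) = cmod (w - z).
Proof. by rewrite -cmodN opprB. Qed.

Lemma cmod_sub_ge z w : cmod z - cmod w <= cmod (z - w).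
Proof. by rewrite lerBlDr -{1}(subrK w z) cmodD. Qed.

Lemma cmodX z n : cmod (z ^+ n) = cmod z ^+ n.
Proof.
by elim: n => [|n IH]; rewrite ?expr0 ?Normc.normc1// !exprS Normc.normcM IH.
Qed.

Lemma cmod_real (x : R) : cmod x%:C = `|x|.
Proof. by rewrite /= expr0n /= addr0 sqrtr_sqr. Qed.

Lemma cmod_nat n : cmod (n%:R : R[i]) = n%:R.
Proof. by rewrite -(rmorph_nat (real_complex R)) cmod_real normr_nat. Qed.

Lemma cmod_sum (I : Type) (s : seq I) (P : pred I) (F : I -> R[i]) :
  cmod (\sum_(i <- s | P i) F i) <= \sum_(i <- s | P i) cmod (F i).
Proof.
elim/big_ind2 : _ => //; first by rewrite Normc.normc0.
by move=> x y z t xy zt; rewrite (le_trans (cmodD _ _))// lerD.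
Qed.

Lemma ReD z w : Re (z + w) = Re z + Re w.
Proof. by case: z; case: w. Qed.

Lemma ImD z w : Im (z + w) = Im z + Im w.
Proof. by case: z; case: w. Qed.

Lemma ReN z : Re (- z) = - Re z.
Proof. by case: z. Qed.

Lemma Re_sum (I : Type) (s : seq I) (P : pred I) (F : I -> R[i]) :
  Re (\sum_(i <- s | P i) F i) = \sum_(i <- s | P i) Re (F i).
Proof. exact: (big_morph (@complex.Re R) ReD (erefl _)). Qed.

Lemma Im_sum (I : Type) (s : seq I) (P : pred I) (F : I -> R[i]) :
  Im (\sum_(i <- s | P i) F i) = \sum_(i <- s | P i) Im (F i).
Proof. exact: (big_morph (@complex.Im R) ImD (erefl _)). Qed.

Lemma Re_mulr z (x : R) : Re (z * x%:C) = Re z * x.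
Proof. by case: z => a b /=; rewrite mulr0 subr0. Qed.

Lemma normr_Re z : `|Re z| <= cmod z.
Proof.
case: z => a b /=; rewrite -(sqrtr_sqr a) ler_wsqrtr//.
by rewrite lerDl sqr_ge0.
Qed.

Lemma normr_Im z : `|Im z| <= cmod z.
Proof.
case: z => a b /=; rewrite -(sqrtr_sqr b) ler_wsqrtr//.
by rewrite lerDr sqr_ge0.
Qed.

Lemma cmod_le_ReIm z : cmod z <= `|Re z| + `|Im z|.
Proof.
rewrite {1}(complexE z) (le_trans (cmodD _ _))// Normc.normcM !cmod_real lerD2l.
by rewrite (_ : cmod 'i = 1) ?mul1r//= expr0n/= add0r expr1n sqrtr1.
Qed.

End cmod_theory.

Section complex_convergence.
Context {R : realType}.

(** The radii in the topology of [R[i]] are positive elements of [R[i]], hence have imaginary part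
    0; this reduces convergence to the real-valued modulus. *)
Lemma cvg_cmodP {T : Type} {F : set_system T} {FF : Filter F}
    (u : T -> R[i]) (l : R[i]) :
  u t @[t --> F] --> l <-> cmod (u t - l) @[t --> F] --> (0 : R).
Proof.
split.
  move/cvgrPdist_lt => ul; apply/cvgrPdist_lt => e e0.
  have e0' : 0 < e%:C :> R[i] by rewrite ltcR.
  apply: filterS (ul _ e0') => t; rewrite distrC cmodE ltcR => h.
  by rewrite sub0r normrN ger0_norm// cmod_ge0.
move/cvgrPdist_lt => ul; apply/cvgrPdist_lt => -[e e'] e0.
have [e'0 {}e0] : e' = 0 /\ 0 < e by move: e0; rewrite ltcE /= => /andP[/eqP -> ->].
apply: filterS (ul _ e0) => t; rewrite sub0r normrN => h.
rewrite distrC cmodE e'0 ltcR; apply: le_lt_trans h; exact: ler_norm.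
Qed.

Lemma cvg_cmod0 {T : Type} {F : set_system T} {FF : Filter F}
    (u : T -> R[i]) (l : R[i]) (v : T -> R) :
  (\forall t \near F, cmod (u t - l) <= v t) -> v t @[t --> F] --> 0 ->
  u t @[t --> F] --> l.
Proof.
move=> uv v0; apply/cvg_cmodP; apply: squeeze_cvgr (cvg_cst 0) v0.
by apply: filterS uv => t ->; rewrite cmod_ge0.
Qed.

Lemma cvg_cmod {T : Type} {F : set_system T} {FF : Filter F}
    (u : T -> R[i]) (l : R[i]) :
  u t @[t --> F] --> l -> cmod (u t) @[t --> F] --> cmod l.
Proof.
move=> /cvg_cmodP ul; apply/cvgrPdist_le => e e0.
have /cvgrPdist_le/(_ e e0) := ul; apply: filterS => t.
rewrite sub0r normrN ger0_norm ?cmod_ge0// => h.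
rewrite ler_norml; apply/andP; split.
  by rewrite lerNl opprB; apply: le_trans h; exact: cmod_sub_ge.
by apply: le_trans h; rewrite cmod_distC; exact: cmod_sub_ge.
Qed.

Lemma cvg_Re {T : Type} {F : set_system T} {FF : Filter F}
    (u : T -> R[i]) (l : R[i]) :
  u t @[t --> F] --> l -> Re (u t) @[t --> F] --> Re l.
Proof.
move=> /cvg_cmodP/cvgrPdist_le ul; apply/cvgrPdist_le => e /ul.
apply: filterS => t; rewrite sub0r normrN ger0_norm ?cmod_ge0// => h; apply: le_trans h.
by rewrite distrC -ReN -ReD normr_Re.
Qed.

Lemma cvg_ReIm {T : Type} {F : set_system T} {FF : Filter F}
    (u : T -> R[i]) (a b : R) :
  Re (u t) @[t --> F] --> a -> Im (u t) @[t --> F] --> b ->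
  u t @[t --> F] --> a +i* b.
Proof.
move=> ua ub.
apply: (@cvg_cmod0 _ _ _ _ _ (fun t => `|Re (u t) - a| + `|Im (u t) - b|)).
  by apply: nearW => t; apply: le_trans (cmod_le_ReIm _) _; case: (u t).
rewrite -[X in _ --> X]addr0; apply: cvgD.
- by rewrite -(normr0 R) -(subrr a); apply: cvg_norm; apply: cvgB => //; exact: cvg_cst.
- by rewrite -(normr0 R) -(subrr b); apply: cvg_norm; apply: cvgB => //; exact: cvg_cst.
Qed.

End complex_convergence.

Section complex_series.
Context {R : realType}.
Implicit Types (u : nat -> R[i]) (v : nat -> R).

Lemma Re_series u n : Re (series u n) = series (Re \o u) n.
Proof. by rewrite /series /= Re_sum. Qed.

Lemma Im_series u n : Im (series u n) = series (Im \o u) n.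
Proof. by rewrite /series /= Im_sum. Qed.

Lemma cvg_series_Re u (l : R[i]) : series u @ \oo --> l ->
  series (Re \o u) @ \oo --> Re l.
Proof.
by move/cvg_Re; apply: cvg_trans; apply: near_eq_cvg; near=> n; rewrite Re_series.
Unshelve. all: by end_near. Qed.

Lemma series_norm_cvg (x : nat -> R) v : (forall n, `|x n| <= v n) ->
  cvgn (series v) -> cvgn (series x).
Proof.
move=> xv cv; apply: normed_cvg; apply: series_le_cvg cv => // n.
  by rewrite /= normr_ge0.
exact: le_trans (normr_ge0 _) (xv n).
Qed.

Lemma cseries_cvg u v : (forall n, cmod (u n) <= v n) ->
  cvgn (series v) -> exists l : R[i], series u @ \oo --> l.
Proof.
move=> uv cv.
have cRe : cvgn (series (Re \o u)).
  by apply: series_norm_cvg cv => n; apply: le_trans (uv n); exact: normr_Re.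
have cIm : cvgn (series (Im \o u)).
  by apply: series_norm_cvg cv => n; apply: le_trans (uv n); exact: normr_Im.
exists (limn (series (Re \o u)) +i* limn (series (Im \o u))).
apply: cvg_ReIm.
  by apply: cvg_trans cRe; apply: near_eq_cvg; near=> n; rewrite Re_series.
by apply: cvg_trans cIm; apply: near_eq_cvg; near=> n; rewrite Im_series.
Unshelve. all: by end_near. Qed.

Lemma cseries_le u v (l : R[i]) (s : R) : (forall n, cmod (u n) <= v n) ->
  series u @ \oo --> l -> series v @ \oo --> s -> cmod l <= s.
Proof.
move=> uv ul vs; have cul : cmod (series u n) @[n --> \oo] --> cmod l by exact: cvg_cmod.
apply: (ler_cvg_to cul vs); near=> n; rewrite /series /=; apply: le_trans (cmod_sum _ _ _) _.
by apply: ler_sum => i _; exact: uv.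
Unshelve. all: by end_near. Qed.

(** The tail keeps its indices, with zeros in front, so that it can be compared termwise with
    another series by [cseries_le]. *)
Lemma series_tail_cvg (V : numFieldType) (v : nat -> V) (s : V) K : series v @ \oo --> s ->
  series (fun n => if (n < K)%N then 0 else v n) @ \oo --> s - series v K.
Proof.
move=> vs.
have : series v n - series v K @[n --> \oo] --> s - series v K.
  by apply: cvgB => //; exact: cvg_cst.
apply: cvg_trans; apply: near_eq_cvg; near=> n.
have Kn : (K <= n)%N by near: n; exact: nbhs_infty_ge.
rewrite sub_series Kn /series /= [in RHS](big_cat_nat (leq0n _) Kn)//= [X in _ = X + _]big1_seq.
  rewrite add0r; apply: eq_big_nat => i /andP[Ki _].
  by rewrite ltnNge Ki.
by move=> i; rewrite mem_index_iota => /andP[_ /andP[_ ->]].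
Unshelve. all: by end_near. Qed.

Lemma cvg_seriesD (V : numFieldType) (u1 u2 : nat -> V) (l1 l2 : V) :
  series u1 @ \oo --> l1 -> series u2 @ \oo --> l2 ->
  series (fun n => u1 n + u2 n) @ \oo --> l1 + l2.
Proof. by move=> h1 h2; rewrite (seriesD u1 u2); exact: cvgD. Qed.

Lemma cvg_seriesB (V : numFieldType) (u1 u2 : nat -> V) (l1 l2 : V) :
  series u1 @ \oo --> l1 -> series u2 @ \oo --> l2 ->
  series (fun n => u1 n - u2 n) @ \oo --> l1 - l2.
Proof.
by move=> h1 h2; rewrite (seriesD u1 (fun n => - u2 n)) (seriesN u2); exact: cvgB.
Qed.

Lemma cvg_seriesZ (V : numFieldType) (k : V) (u : nat -> V) (l : V) :
  series u @ \oo --> l -> series (fun n => k * u n) @ \oo --> k * l.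
Proof. by move=> h; rewrite (seriesZ (V := V^o) u k); exact: cvgZr. Qed.

Lemma cvg_series_shift (V : numFieldType) (u : nat -> V) (l : V) :
  series u @ \oo --> l -> series (fun n => u n.+1) @ \oo --> l - u 0.
Proof.
move=> ul; have : series u n.+1 - u 0 @[n --> \oo] --> l - u 0.
  by apply: cvgB; [rewrite (cvg_shiftS (series u))|exact: cvg_cst].
apply: cvg_trans; apply: near_eq_cvg; near=> n.
by rewrite /series /= big_nat_recl// addrC addKr.
Unshelve. all: by end_near. Qed.

Lemma cvg_series_finite (V : numFieldType) (u : nat -> V) K :
  (forall n, (K <= n)%N -> u n = 0) -> series u @ \oo --> series u K.
Proof.
move=> u0; apply: cvg_near_cst; near=> n.
have Kn : (K <= n)%N by near: n; exact: nbhs_infty_ge.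
rewrite /series /= (big_cat_nat (leq0n _) Kn)//= [X in _ + X]big1_seq ?addr0//.
by move=> i; rewrite mem_index_iota => /andP[_ /andP[/u0]].
Unshelve. all: by end_near. Qed.

Lemma cvg_series_sum (V : numFieldType) (u : nat -> nat -> V) (l : nat -> V) K :
  (forall k, (k < K)%N -> series (u k) @ \oo --> l k) ->
  series (fun n => \sum_(k < K) u k n) @ \oo --> \sum_(k < K) l k.
Proof.
elim: K => [|K IH] H.
  rewrite big_ord0 (_ : (fun n => _) = fun=> 0); last first.
    by apply/funext => n; rewrite big_ord0.
  by have := @cvg_series_finite V (fun=> 0) 0 (fun _ _ => erefl); rewrite /series/= big_nil.
rewrite big_ord_recr /= (_ : (fun n => _) = (fun n => \sum_(k < K) u k n + u K n)).
  by apply: cvg_seriesD; [apply: IH => k kK; apply: H; exact: ltnW|exact: H].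
by apply/funext => n; rewrite big_ord_recr.
Qed.

End complex_series.

(** * Power series *)

Section power_series.
Context {R : realType}.
Implicit Types (f : R[i] -> R[i]) (a b : nat -> R[i]) (c w z : R[i]).

(** At a radius p strictly between s and r the terms tend to 0, hence are bounded; at radius s they
    are dominated by a geometric series of ratio s / p. *)
Lemma power_series_abs_cvg f c (r : R) a (s : R) : power_series_at f c r a ->
  0 <= s < r -> cvgn (series (fun n => cmod (a n) * s ^+ n)).
Proof.
move=> fa /andP[s0 sr].
pose p := (s + r) / 2.
have p0 : 0 < p by rewrite /p; lra.
have pr : p < r by rewrite /p; lra.
have sp : s < p by rewrite /p; lra.
move: p p0 pr sp => p p0 pr sp.
have /fa : cmod (c + p%:C - c) < r.
  by rewrite addrC addKr cmod_real gtr0_norm.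
rewrite (addrC c) addrK => cp.
have t0 : cmod (a n * p%:C ^+ n) @[n --> \oo] --> (0 : R).
  rewrite -(@Normc.normc0 R); apply: cvg_cmod.
  by apply: (@cvg_series_cvg_0 _ R[i]^o); apply/cvg_ex; exists (f (p%:C + c)).
have [M [_ /(_ (M + 1))]] : bounded_fun (fun n => cmod (a n * p%:C ^+ n)).
  by apply: cvg_seq_bounded; apply/cvg_ex; exists 0.
rewrite ltrDl ltr01 => /(_ isT) aM.
have q1 : `|s / p| < 1.
  by rewrite (ger0_norm (divr_ge0 s0 (ltW p0))) ltr_pdivrMr// mul1r.
apply: series_le_cvg (is_cvg_geometric_series (a := M + 1) q1) => n.
- by rewrite mulr_ge0 ?cmod_ge0// exprn_ge0.
- rewrite /geometric /= mulr_ge0//; last by rewrite exprn_ge0// (divr_ge0 s0 (ltW p0)).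
  exact: le_trans (aM n I).
- have := aM n I; rewrite /= ger0_norm ?cmod_ge0// Normc.normcM cmodX cmod_real.
  rewrite gtr0_norm// => h.
  rewrite /geometric /= -{1}(divfK (lt0r_neq0 p0) s) exprMn mulrCA mulrC.
  by rewrite ler_wpM2r// exprn_ge0// (divr_ge0 s0 (ltW p0)).
Qed.

Lemma power_series_center f c (r : R) a : power_series_at f c r a -> 0 < r ->
  f c = a 0.
Proof.
move=> fa r0; have /fa h : cmod (c - c) < r by rewrite subrr Normc.normc0.
have h1 : series (fun k => a k * (c - c) ^+ k) @ \oo --> a 0.
  have -> : a 0 = series (fun k => a k * (c - c) ^+ k) 1.
    by rewrite /series /= big_nat1 expr0 mulr1.
  by apply: cvg_series_finite => -[|n]// _; rewrite subrr expr0n mulr0.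
exact: cvg_unique h h1.
Qed.

(** With s = r / 2, |h|^k <= |h|^2 s^(k - 2) for k >= 2, so the terms beyond the linear one add up
    to at most |h|^2 / s^2 times the sum of the |a_k| s^k. *)
Lemma power_series_remainder f c (r : R) a : power_series_at f c r a -> 0 < r ->
  exists K : R, forall h, cmod h < r / 2 ->
    cmod (f (h + c) - f c - a 1 * h) <= K * cmod h ^+ 2.
Proof.
move=> fa r0; pose s := r / 2.
have s0 : 0 < s by rewrite /s; lra.
have sr : s < r by rewrite /s; lra.
have := @power_series_abs_cvg f c r a s fa.
rewrite (ltW s0) sr => /(_ isT) /cvg_ex[/= T cT].
exists (T / s ^+ 2) => h hs.
have /fa : cmod (h + c - c) < r by rewrite addrK (lt_trans hs).
rewrite addrK => /(@series_tail_cvg _ _ _ 2) ch.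
have -> : f (h + c) - f c - a 1 * h = f (h + c) - series (fun k => a k * h ^+ k) 2.
  rewrite (power_series_center fa r0) /series /= big_nat_recr//= big_nat1.
  by rewrite expr0 expr1 mulr1 opprD addrA.
have -> : T / s ^+ 2 * cmod h ^+ 2 = cmod h ^+ 2 / s ^+ 2 * T.
  by rewrite mulrC mulrCA mulrC.
apply: (cseries_le _ ch (@cvg_seriesZ _ (cmod h ^+ 2 / s ^+ 2) _ _ cT)) => k.
case: ltnP => [_|k2].
  by rewrite Normc.normc0 !mulr_ge0 ?invr_ge0 ?exprn_ge0 ?cmod_ge0 ?(ltW s0).
rewrite Normc.normcM cmodX mulrCA ler_wpM2l ?cmod_ge0//.
have -> : cmod h ^+ 2 / s ^+ 2 * s ^+ k = s ^+ (k - 2) * cmod h ^+ 2.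
  rewrite -{1}(subnK k2) exprD; move: (s ^+ (k - 2)) => q; field.
  exact: lt0r_neq0.
rewrite -{1}(subnK k2) exprD ler_wpM2r ?exprn_ge0 ?cmod_ge0//.
by rewrite lerXn2r ?nnegrE ?cmod_ge0 ?(ltW s0)// ltW.
Qed.

Lemma power_series_is_derive f c (r : R) a : power_series_at f c r a -> 0 < r ->
  is_derive c 1 f (a 1).
Proof.
move=> fa r0; have [K HK] := power_series_remainder fa r0.
have H : h^-1 *: (f (h *: 1 + c) - f c) @[h --> (0 : R[i])^'] --> a 1.
  apply: (@cvg_cmod0 _ _ _ _ _ _ (fun h => `|K| * cmod h)).
    have : \forall h \near (0 : R[i])^', h != 0 by exact: nbhs_dnbhs_neq.
    have : \forall h \near (0 : R[i])^', cmod h < r / 2.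
      apply: nbhs_dnbhs; apply/nbhs_ballP; exists (r / 2)%:C => /=.
        by rewrite ltcR; lra.
      by move=> h; rewrite /ball /= sub0r normrN cmodE ltcR.
    apply: filterS2 => h hr h0.
    rewrite [h *: 1]mulr1.
    have h0' : 0 < cmod h.
      by rewrite lt0r cmod_ge0 andbT; apply: contraNN h0 => /eqP/Normc.eq0_normc ->.
    have -> : h^-1 *: (f (h + c) - f c) - a 1 = h^-1 * (f (h + c) - f c - a 1 * h).
      by rewrite mulrBr mulrCA mulVf// mulr1.
    rewrite Normc.normcM Normc.normcV mulrC ler_pdivrMr//.
    apply: le_trans (HK _ hr) _; rewrite -mulrA -expr2 ler_wpM2r ?ler_norm//.
    by rewrite exprn_ge0// cmod_ge0.
  rewrite -(mulr0 `|K|); apply: cvgZr.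
  rewrite -(@Normc.normc0 R); apply: cvg_cmod.
  by move=> A A0; apply: nbhs_dnbhs.
apply: DeriveDef; first by apply/cvg_ex; exists (a 1).
by apply/cvg_lim => //; exact: norm_hausdorff.
Qed.

End power_series.

(** * Change of centre and termwise differentiation *)

Section reexpansion.
Context {R : realType}.
Implicit Types (f g : R[i] -> R[i]) (a b : nat -> R[i]) (c w z : R[i]).

Lemma power_series_at0P f (r : R) a : power_series_at f 0 r a <->
  forall z, cmod z < r -> series (fun k => a k * z ^+ k) @ \oo --> f z.
Proof.
by split=> h z; [have := h z; rewrite subr0|rewrite subr0; exact: h].
Qed.

(** This is f^(k)(c) / k!, obtained by collecting the powers of w in the sum of the a_n (c +
    w)^n. *)
Definition recentered_coef a c k : R[i] :=
  limn (series (fun n => a n * 'C(n, k)%:R * c ^+ (n - k))).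

Lemma le_binomial_term (x y : R) n k : 0 <= x -> 0 <= y ->
  'C(n, k)%:R * x ^+ (n - k) * y ^+ k <= (x + y) ^+ n.
Proof.
move=> x0 y0; have [kn|nk] := leqP k n; last first.
  by rewrite bin_small// !mul0r exprn_ge0// addr_ge0.
have kn' : (k < n.+1)%N by [].
rewrite exprDn (bigD1 (Ordinal kn'))//= -[X in X <= _]addr0 lerD//.
  by rewrite -[leRHS]mulr_natl mulrA.
by apply: sumr_ge0 => i _; rewrite mulrn_wge0// mulr_ge0// exprn_ge0.
Qed.

Lemma recentered_coef_cvg f a c k : power_series_at f 0 1 a -> cmod c < 1 ->
  series (fun n => a n * 'C(n, k)%:R * c ^+ (n - k)) @ \oo -->
    recentered_coef a c k.
Proof.
move=> fa c1; pose s := (1 - cmod c) / 2.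
have s0 : 0 < s by rewrite /s; lra.
have := power_series_abs_cvg (s := cmod c + s) fa.
have -> : 0 <= cmod c + s < 1.
  by have := cmod_ge0 c; rewrite /s => ?; apply/andP; split; lra.
move=> /(_ isT) /cvg_ex[/= T cT].
have [|l cl] := @cseries_cvg R (fun n => a n * 'C(n, k)%:R * c ^+ (n - k)) _ _
    (cvgP _ (@cvg_seriesZ _ (s ^- k) _ _ cT)).
  move=> n; rewrite mulrCA -mulrA Normc.normcM ler_wpM2l ?cmod_ge0//.
  rewrite ler_pdivlMl ?exprn_gt0// Normc.normcM cmod_nat cmodX mulrC.
  by apply: le_binomial_term; rewrite ?cmod_ge0// ltW.
by rewrite /recentered_coef; apply/cvg_ex; exists l.
Qed.

(** For n < K the binomial sum is complete; otherwise the missing terms are, in modulus, part of the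
    expansion of (|c| + |w|)^n. *)
Lemma exprDn_tail c w n K : cmod ((c + w) ^+ n -
    \sum_(k < K) 'C(n, k)%:R * c ^+ (n - k) * w ^+ k) <=
  if (n < K)%N then 0 else (cmod c + cmod w) ^+ n.
Proof.
have E (x y : R[i]) : (x + y) ^+ n =
    \sum_(0 <= k < n.+1) 'C(n, k)%:R * x ^+ (n - k) * y ^+ k.
  rewrite exprDn big_mkord; apply: eq_bigr => i _.
  by rewrite -[LHS]mulr_natl mulrA.
rewrite -(big_mkord xpredT (fun k => 'C(n, k)%:R * c ^+ (n - k) * w ^+ k)).
case: ltnP => [nK|Kn].
  rewrite E (big_cat_nat (leq0n _) nK)/= [X in _ - (_ + X)]big1_seq.
    by rewrite addr0 subrr Normc.normc0.
  move=> i; rewrite mem_index_iota => /andP[_ /andP[ni _]].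
  by rewrite bin_small// !mul0r.
rewrite E (big_cat_nat (leq0n _) (leqW Kn))/= addrAC subrr add0r.
apply: le_trans (cmod_sum _ _ _) _.
have -> : (cmod c + cmod w) ^+ n =
    \sum_(0 <= k < n.+1) 'C(n, k)%:R * cmod c ^+ (n - k) * cmod w ^+ k.
  rewrite exprDn big_mkord; apply: eq_bigr => i _.
  by rewrite -[LHS]mulr_natl mulrA.
rewrite [leRHS](big_cat_nat (leq0n _) (leqW Kn))/= -[leLHS]add0r lerD//.
  by apply: sumr_ge0 => i _; rewrite !mulr_ge0// exprn_ge0// cmod_ge0.
by apply: ler_sum => i _; rewrite !Normc.normcM !cmodX cmod_nat.
Qed.

(* The difference between [f (c + w)] and the sum of the first [K] terms is
   dominated by the tail [sum_(n >= K) |a_n| (|c| + |w|)^n]. *)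
Lemma recenter f a c : power_series_at f 0 1 a -> cmod c < 1 ->
  power_series_at f c (1 - cmod c) (recentered_coef a c).
Proof.
move=> fa c1 z; set w := z - c; rewrite (_ : z = c + w); last first.
  by rewrite /w addrC subrK.
move: w => w; move: z => _ wc.
have := power_series_abs_cvg (s := cmod c + cmod w) fa.
have -> : 0 <= cmod c + cmod w < 1.
  by have := cmod_ge0 c; have := cmod_ge0 w => ? ?; apply/andP; split; lra.
move=> /(_ isT) /cvg_ex[/= T cT].
have /power_series_at0P/(_ (c + w)) := fa.
have -> : cmod (c + w) < 1 by apply: le_lt_trans (cmodD _ _) _; lra.
move=> /(_ isT) cf.
apply: (@cvg_cmod0 _ _ _ _ _ _
  (fun K => T - series (fun n => cmod (a n) * (cmod c + cmod w) ^+ n) K)).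
  apply: nearW => K; rewrite cmod_distC.
  (* For finitely many k, exchanging the two summations is linearity; the full double sum is reached
     by letting K grow. *)
  have cK : series (fun n => \sum_(k < K) a n * 'C(n, k)%:R * c ^+ (n - k) * w ^+ k)
      @ \oo --> series (fun k => recentered_coef a c k * w ^+ k) K.
    have -> : series (fun k => recentered_coef a c k * w ^+ k) K =
        \sum_(k < K) w ^+ k * recentered_coef a c k.
      by rewrite /series /= big_mkord; apply: eq_bigr => k _; rewrite mulrC.
    apply: (@cvg_series_sum _
      (fun k n => a n * 'C(n, k)%:R * c ^+ (n - k) * w ^+ k)
      (fun k => w ^+ k * recentered_coef a c k)) => k _.
    under [X in series X]funext => n do rewrite mulrC.
    apply: cvg_seriesZ.
    exact: recentered_coef_cvg fa c1.
  have cB := cvg_seriesB cf cK.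
  have cTK := @series_tail_cvg _ _ _ K cT.
  apply: (cseries_le _ cB cTK) => n.
  have -> : a n * (c + w) ^+ n -
      \sum_(k < K) a n * 'C(n, k)%:R * c ^+ (n - k) * w ^+ k =
      a n * ((c + w) ^+ n - \sum_(k < K) 'C(n, k)%:R * c ^+ (n - k) * w ^+ k).
    by rewrite mulrBr mulr_sumr; congr (_ - _); apply: eq_bigr => k _; rewrite !mulrA.
  rewrite Normc.normcM; apply: le_trans (ler_wpM2l (cmod_ge0 _) (exprDn_tail _ _ _ _)) _.
  by case: ltnP; rewrite ?mulr0.
rewrite -(subrr T); apply: cvgB => //; exact: cvg_cst.
Qed.

Lemma power_series_analytic f a : power_series_at f 0 1 a -> analytic_on_disc f.
Proof.
move=> fa c; rewrite /disc /= => c1; exists (1 - cmod c), (recentered_coef a c).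
by rewrite subr_gt0; split => //; exact: recenter.
Qed.

Lemma analytic_derivable f z : analytic_on_disc f -> disc z -> derivable f z 1.
Proof.
by move=> fan /fan[r [a [r0 fa]]]; have [] := power_series_is_derive fa r0.
Qed.

Lemma derive1B f g z : derivable f z 1 -> derivable g z 1 ->
  derive1 (f \- g) z = derive1 f z - derive1 g z.
Proof.
move=> df dg; have H : 'D_1 (f - g) z = 'D_1 f z - 'D_1 g z by rewrite deriveB.
rewrite (derive1E f) (derive1E g) (derive1E (f \- g)).
by have -> : f \- g = f - g by []; rewrite H.
Qed.

(** The derivative at z is the linear coefficient of the expansion recentered at z, and
    [recentered_coef a z 1] is the termwise derivative. *)
Lemma power_series_derive1 f a z : power_series_at f 0 1 a -> cmod z < 1 ->
  series (fun n => a n.+1 * n.+1%:R * z ^+ n) @ \oo --> derive1 f z.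
Proof.
move=> fa z1; have z1' : 0 < 1 - cmod z by rewrite subr_gt0.
have df := power_series_is_derive (recenter fa z1) z1'.
rewrite derive1E derive_val.
have := cvg_series_shift (recentered_coef_cvg (k := 1) fa z1).
rewrite bin0n mulr0 mul0r subr0.
by under [X in series X]funext => n do rewrite bin1 subn1.
Qed.

End reexpansion.

(** * Roots of unity and Cauchy's estimate *)

Section cauchy_estimate.

(** X^n - 1 splits and is separable, so it has n distinct roots, and such a group of roots of unity
    is cyclic. *)
Lemma closed_prim_root (F : numClosedFieldType) n : (0 < n)%N ->
  exists z : F, n.-primitive_root z.
Proof.
move=> n0; pose p : {poly F} := 'X^n - 1.
have [r Dp] := closed_field_poly_normal p.
rewrite (monicP _) ?monicXnsubC// scale1r in Dp.
have rn1 : all n.-unity_root r by apply/allP => z; rewrite -root_prod_XsubC -Dp.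
have sz_r : (n < (size r).+1)%N.
  by rewrite -(size_prod_XsubC r id) -Dp size_XnsubC.
have [|z] := hasP (has_prim_root n0 rn1 _ sz_r); last by exists z.
by rewrite -separable_prod_XsubC -Dp separable_Xn_sub_1// pnatr_eq0 -lt0n.
Qed.

Lemma sum_prim_root (F : fieldType) n (z : F) d : n.-primitive_root z ->
  \sum_(j < n) z ^+ (j * d) = if (n %| d)%N then n%:R else 0.
Proof.
move=> zn; under eq_bigr => j _ do rewrite mulnC exprM.
rewrite (prim_order_dvd zn).
case: eqVneq => [->|zd1].
  by under eq_bigr => j _ do rewrite expr1n; rewrite sumr_const card_ord.
apply/eqP; have : (z ^+ d - 1) * (\sum_(j < n) (z ^+ d) ^+ j) == 0.
  by rewrite -subrX1 -exprM mulnC exprM (prim_expr_order zn) expr1n subrr.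
by rewrite mulf_eq0 subr_eq0 (negbTE zd1).
Qed.

Context {R : realType}.
Implicit Types (f : R[i] -> R[i]) (a b : nat -> R[i]) (c w z : R[i]).

(* Average over the circle by means of the [N]-th roots of unity. *)
Lemma cauchy_estimate_poly b N m (r M : R) : (m < N)%N -> 0 <= r ->
  (forall z, cmod z = r -> cmod (\sum_(k < N) b k * z ^+ k) <= M) ->
  cmod (b m) * r ^+ m <= M.
Proof.
move=> mN r0 bM; have N0 : (0 < N)%N by exact: leq_ltn_trans mN.
have [w wN] := closed_prim_root R[i] N0.
have w1 : cmod w = 1.
  apply/eqP; rewrite -(pexpr_eq1 (n := N))// ?cmod_ge0//.
  by rewrite -cmodX (prim_expr_order wN) Normc.normc1.
(* The factor w^(j (N - m)) stands for w^(- j m): the average over the roots of unity picks out the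
   coefficient of index m. *)
have E : \sum_(j < N) w ^+ (j * (N - m)) * \sum_(k < N) b k * (r%:C * w ^+ j) ^+ k
    = N%:R * (b m * r%:C ^+ m).
  under eq_bigr => j _ do rewrite mulr_sumr.
  rewrite exchange_big /= (bigD1 (Ordinal mN))//= [X in _ + X]big1 ?addr0; last first.
    move=> k km.
    transitivity (b k * r%:C ^+ k * \sum_(j < N) w ^+ (j * (N - m + k))).
      rewrite mulr_sumr; apply: eq_bigr => j _.
      by rewrite mulnDr exprD exprMn -exprM; ring.
    (* Since 0 < N - m + k < 2 N, divisibility by N would force k = m. *)
    rewrite (sum_prim_root _ wN) ifF ?mulr0//.
    apply: contra_neqF km => /dvdnP[q qE]; apply/val_inj => /=.
    have := ltn_ord k; move: qE mN; case: q => [|[|q]]; lia.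
  transitivity (b m * r%:C ^+ m * \sum_(j < N) w ^+ (j * (N - m + m))).
    rewrite mulr_sumr; apply: eq_bigr => j _.
    by rewrite mulnDr exprD exprMn -exprM; ring.
  by rewrite (sum_prim_root _ wN) subnK ?dvdnn 1?ltnW// mulrC.
have : cmod (N%:R * (b m * r%:C ^+ m)) <= N%:R * M.
  rewrite -E; apply: le_trans (cmod_sum _ _ _) _.
  have -> : N%:R * M = \sum_(j < N) M by rewrite sumr_const card_ord mulr_natl.
  apply: ler_sum => j _.
  rewrite Normc.normcM cmodX w1 expr1n mul1r; apply: bM.
  by rewrite Normc.normcM cmodX w1 expr1n mulr1 cmod_real ger0_norm.
rewrite !Normc.normcM cmod_nat cmodX cmod_real (ger0_norm r0).
by rewrite ler_pM2l// ltr0n.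
Qed.

(** On the circle of radius r the N-th partial sum is at most M plus the tail of the series of the
    |b_n| r^n. The polynomial estimate applies with this bound, and the tail vanishes as N grows. *)
Lemma cauchy_estimate f b m (r M : R) : power_series_at f 0 1 b ->
  0 <= r < 1 -> (forall z, cmod z = r -> cmod (f z) <= M) ->
  cmod (b m) * r ^+ m <= M.
Proof.
move=> fb r01 fM.
have /cvg_ex[/= T cT] := power_series_abs_cvg fb r01.
have /andP[r0 r1] := r01.
have cN : M + (T - series (fun n => cmod (b n) * r ^+ n) N) @[N --> \oo] --> M + (T - T).
  by apply: cvgD; [exact: cvg_cst|apply: cvgB => //; exact: cvg_cst].
rewrite subrr addr0 in cN.
apply: (ler_cvg_to (cvg_cst (cmod (b m) * r ^+ m)) cN).
near=> N; have mN : (m < N)%N by near: N; exact: nbhs_infty_gt.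
apply: cauchy_estimate_poly mN r0 _ => z zr.
have /power_series_at0P/(_ z) := fb; rewrite zr r1 => /(_ isT) cz.
rewrite -(big_mkord xpredT (fun k => b k * z ^+ k)).
rewrite -[X in cmod X](subKr (f z)) (le_trans (cmodB _ _))//; apply: lerD; first exact: fM.
apply: (cseries_le _ (@series_tail_cvg _ _ _ N cz) (@series_tail_cvg _ _ _ N cT)) => n.
by case: ifP => _; rewrite ?Normc.normc0// Normc.normcM cmodX zr.
Unshelve. all: by end_near. Qed.

(** Cauchy's estimate with M = 0 on the circle of radius 1/2, applied to the difference of the two
    expansions. *)
Lemma power_series_unique f a b :
  power_series_at f 0 1 a -> power_series_at f 0 1 b -> a = b.
Proof.
move=> /power_series_at0P fa /power_series_at0P fb.
have h : power_series_at (fun=> 0 : R[i]) 0 1 (fun n => a n - b n).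
  apply/power_series_at0P => z z1.
  have := cvg_seriesB (fa z z1) (fb z z1); rewrite subrr.
  by under [X in series X @ _ --> _]funext => n do rewrite -mulrBl.
apply/funext => m.
have r01 : 0 <= (2^-1 : R) < 1 by apply/andP; split; lra.
have H0 (z : R[i]) : cmod z = 2^-1 :> R -> cmod (0 : R[i]) <= 0 by rewrite Normc.normc0.
have := cauchy_estimate m h r01 H0; rewrite pmulr_lle0; last by rewrite exprn_gt0// invr_gt0.
move=> ab0; apply/eqP; rewrite -subr_eq0; apply/eqP/Normc.eq0_normc.
by apply/eqP; rewrite eq_le ab0 cmod_ge0.
Qed.

Lemma taylor_coefE f a : power_series_at f 0 1 a -> taylor_coef f = a.
Proof.
move=> fa; rewrite /taylor_coef; case: xgetP => [b _ fb|/(_ a)//].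
exact: power_series_unique fb fa.
Qed.

Lemma taylor_coef_default f : ~ (exists a, power_series_at f 0 1 a) ->
  taylor_coef f = fun=> 0.
Proof.
by move=> nfa; rewrite /taylor_coef; case: xgetP => // b _ fb; case: nfa; exists b.
Qed.

End cauchy_estimate.

(** * The coefficients Gamma (n + b) / (n! Gamma b) *)

Section binomial_coefficients.
Context {R : realType}.
Implicit Types (b p r x : R).

(* The Taylor coefficients of [(1 - z) ^ (- b)], that is
   [Gamma (n + b) / (n! Gamma b)]. *)
Definition neg_binom b n : R := \prod_(j < n) ((b + j%:R) / j.+1%:R).

Lemma neg_binom0 b : neg_binom b 0 = 1.
Proof. by rewrite /neg_binom big_ord0. Qed.

Lemma neg_binomS b n : neg_binom b n.+1 = neg_binom b n * ((b + n%:R) / n.+1%:R).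
Proof. by rewrite /neg_binom big_ord_recr. Qed.

Lemma neg_binomS_mul b n :
  n.+1%:R * neg_binom b n.+1 = (b + n%:R) * neg_binom b n.
Proof.
rewrite neg_binomS mulrCA (mulrC n.+1%:R) divfK 1?mulrC//.
Qed.

Lemma neg_binom_gt0 b n : 0 < b -> 0 < neg_binom b n.
Proof.
move=> b0; elim: n => [|n IH]; first by rewrite neg_binom0.
by rewrite neg_binomS mulr_gt0// divr_gt0// ltr_wpDr.
Qed.

Lemma neg_binom1 n : neg_binom 1 n = 1.
Proof.
elim: n => [|n IH]; first by rewrite neg_binom0.
by rewrite neg_binomS IH mul1r -natr1 addrC divff// natr1 pnatr_eq0.
Qed.

(** Both sides are b (b + 1) ... (b + n) / n!. *)
Lemma neg_binom_shift b n :
  b * neg_binom (b + 1) n = (b + n%:R) * neg_binom b n.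
Proof.
elim: n => [|n IH]; first by rewrite !neg_binom0 addr0.
rewrite !neg_binomS mulrA IH -natr1.
have : (n%:R + 1 : R) != 0 by rewrite natr1 pnatr_eq0.
by move=> n0; field.
Qed.

(** In generating functions: z times the derivative of (1 - z)^-b is b z (1 - z)^-(b + 1), and
    summing coefficients divides by 1 - z. *)
Lemma sum_neg_binom b N : 0 < b ->
  \sum_(n < N.+2) n%:R * neg_binom b n = b * neg_binom (b + 2) N.
Proof.
move=> b0; elim: N => [|N IH].
  rewrite !big_ord_recr big_ord0/= mul0r !add0r mul1r neg_binomS !neg_binom0.
  by rewrite addr0 mul1r divr1 mulr1.
rewrite big_ord_recr /= IH neg_binomS_mul -neg_binom_shift -mulrDr.
congr (b * _); have b1 : b + 1 != 0 by rewrite lt0r_neq0// addr_gt0.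
have n0 : (N.+1%:R : R) != 0 by rewrite pnatr_eq0.
have H := neg_binom_shift (b + 1) N.
have -> : b + 2 = b + 1 + 1 by rewrite -addrA.
apply: (mulfI b1); rewrite mulrDr H !neg_binomS.
rewrite (mulrA (b + 1) (neg_binom (b + 1 + 1) N)) H -natr1.
by field; rewrite natr1.
Qed.

(** Equality holds at N = 0. The induction compares growth factors: p ln (1 + 1 / (N + p + 1)) <= p
    / (N + p + 1) <= ln ((N + p + 1) / (N + 1)). Both bounds are instances of ln (1 + x) <= x, the
    second one for the reciprocal. *)
Lemma neg_binom_ge p N : 0 <= p ->
  ((N%:R + p + 1) / (p + 1)) `^ p <= neg_binom (p + 1) N.
Proof.
move=> p0; have p1 : 0 < p + 1 by rewrite ltr_wpDl.
elim: N => [|N IH].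
  by rewrite add0r divff ?powR1 ?neg_binom0// lt0r_neq0.
have a0 : 0 < N%:R + p + 1 by rewrite -addrA ltr_wpDl.
rewrite neg_binomS.
have -> : (N.+1%:R + p + 1) / (p + 1) =
    (N%:R + p + 1) / (p + 1) * ((N%:R + p + 2) / (N%:R + p + 1)).
  by rewrite -natr1; field; rewrite !lt0r_neq0.
have a2 : 0 < N%:R + p + 2 by rewrite -addrA ltr_wpDl// ltr_wpDl.
rewrite powRM ?divr_ge0 ?(ltW p1) ?(ltW a0) ?(ltW a2)//.
apply: ler_pM => //; rewrite ?powR_ge0//.
have n1 : 0 < N.+1%:R :> R by rewrite ltr0n.
have q0 : 0 < (p + 1 + N%:R) / N.+1%:R by rewrite divr_gt0// addrC addrA.
have y0 : 0 < (N%:R + p + 2) / (N%:R + p + 1) by rewrite divr_gt0.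
rewrite -ler_ln ?posrE ?powR_gt0// ln_powR.
apply: (@le_trans _ _ (p / (N%:R + p + 1))).
  rewrite ler_wpM2l//.
  rewrite (_ : _ / _ = 1 + (N%:R + p + 1)^-1); last first.
    by field; rewrite lt0r_neq0.
  by rewrite le_ln1Dx// (lt_trans (ltrN10 _))// invr_gt0.
rewrite -lerN2 -lnV ?posrE//.
rewrite (_ : _^-1 = 1 + (- (p / (N%:R + p + 1)))); last first.
  by rewrite -natr1; field; rewrite !lt0r_neq0//= -?natr1 addrC ?addrA// addrC addrA.
by rewrite le_ln1Dx// ltrN2 ltr_pdivrMr// mul1r -addrA addrCA ltrDl ltr_wpDl.
Qed.

Lemma is_derive_horner_powR (q : {poly R}) b x : x < 1 ->
  is_derive x 1 (fun x => q.[x] * (1 - x) `^ b)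
    (q^`().[x] * (1 - x) `^ b - b * (1 - x) `^ (b - 1) * q.[x]).
Proof.
move=> x1; have x1' : 0 < 1 - x by rewrite subr_gt0.
have d1 : is_derive x 1 (horner q) (q^`().[x]).
  by rewrite derivE; apply: DeriveDef; rewrite ?derive1E//; exact: derivable_horner.
have d2 : is_derive x 1 (fun x => 1 - x) (-1 : R).
  by apply: is_derive_eq; rewrite add0r mul1r.
have d3 := is_derive1_powR b x1'.
have d4 := @is_derive1_comp R (@powR R ^~ b) (fun x : R => 1 - x) x _ _ d3 d2.
have d5 := is_deriveM d1 d4.
apply: is_derive_eq.
rewrite /GRing.scale /=; ring.
Qed.

(* With [S] the partial sum, [(1 - x) S'(x) <= b S(x)], so that
   [S(x) (1 - x)^b] decreases from its value [1] at [x = 0]. *)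
Lemma sum_neg_binom_le b N r : 0 < b -> 0 <= r < 1 ->
  (\sum_(n < N) neg_binom b n * r ^+ n) * (1 - r) `^ b <= 1.
Proof.
move=> b0 /andP[r0 r1].
pose q : {poly R} := \poly_(n < N) neg_binom b n.
have qE x : q.[x] = \sum_(n < N) neg_binom b n * x ^+ n by rewrite horner_poly.
have b_ge0 := ltW b0.
have g0 n : 0 <= neg_binom b n by rewrite ltW// neg_binom_gt0.
(* Coefficientwise this is (n + 1) g(n + 1) = n g(n) + b g(n), with equality except at n = N - 1,
   where the truncation has removed g(N). *)
have dq x : 0 <= x -> (1 - x) * q^`().[x] <= b * q.[x].
  move=> x0.
  have -> : q^`().[x] = \sum_(i < N) q`_i.+1 *+ i.+1 * x ^+ i.
    rewrite (@horner_coef_wide _ N).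
      by apply: eq_bigr => i _; rewrite coef_deriv.
    by rewrite (leq_trans (size_poly _ _))// (leq_trans (leq_pred _))// size_poly.
  have xq : x * (\sum_(i < N) q`_i.+1 *+ i.+1 * x ^+ i) =
      \sum_(i < N) i%:R * neg_binom b i * x ^+ i.
    transitivity (\sum_(i < N.+1) i%:R * q`_i * x ^+ i).
      rewrite big_ord_recl mul0r mul0r add0r mulr_sumr; apply: eq_bigr => i _.
      by rewrite /= /bump /= add1n exprS -[q`_i.+1 *+ i.+1]mulr_natl; ring.
    rewrite big_ord_recr /= coef_poly ltnn mulr0 mul0r addr0.
    by apply: eq_bigr => i _; rewrite coef_poly ltn_ord.
  rewrite mulrBl mul1r xq lerBlDr qE mulr_sumr -big_split/=.
  apply: ler_sum => i _; rewrite coef_poly.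
  have -> : b * (neg_binom b i * x ^+ i) + i%:R * neg_binom b i * x ^+ i =
      (i.+1%:R * neg_binom b i.+1) * x ^+ i.
    by rewrite neg_binomS_mul; ring.
  rewrite ler_wpM2r ?exprn_ge0//; case: ifP => _; first by rewrite mulr_natl.
  by rewrite mul0rn mulr_ge0.
have dF x : x < 1 -> _ := @is_derive_horner_powR q b x.
have := @ler0_derive1_le_cc _ (fun x => q.[x] * (1 - x) `^ b) 0 r.
have F0 : q.[0] * (1 - 0) `^ b <= 1.
  rewrite subr0 powR1 mulr1 qE; case: N {q qE dq dF} => [|N]; first by rewrite big_ord0.
  rewrite big_ord_recl neg_binom0 expr0 mulr1 big1 ?addr0// => i _.
  by rewrite expr0n/= mulr0.
move=> /(_ _ _ _ r 0) H; rewrite -qE; apply: le_trans F0; apply: H => //.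
- move=> x; rewrite in_itv/= => /andP[x0 xr].
  by have [] := dF x (lt_trans xr r1).
- move=> x; rewrite in_itv/= => /andP[x0 xr].
  have x1 := lt_trans xr r1.
  have dFx := dF x x1; rewrite derive1E derive_val.
  have x1' : 0 < 1 - x by rewrite subr_gt0.
  rewrite -(mulr_powRB1 (ltW x1') b0) subr_le0 mulrA mulrC mulrA -subr_ge0.
  rewrite (_ : _ - _ = (1 - x) `^ (b - 1) * (b * q.[x] - (1 - x) * q^`().[x])); last by ring.
  by rewrite mulr_ge0 ?powR_ge0// subr_ge0 dq// ltW.
- apply: derivable_within_continuous => x; rewrite in_itv/= => /andP[x0 xr].
  by have [] := dF x (le_lt_trans xr r1).
- by rewrite in_itv/= lexx r0.
- by rewrite in_itv/= lexx r0.
Qed.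

End binomial_coefficients.

(** * Euler's Gamma function: recursion and positivity *)

Section gamma_function.
Context {R : realType}.
Implicit Types (p s t : R).
Notation leb := (@lebesgue_measure R).

Lemma is_derive1_continuous (f : R -> R) t d : is_derive t 1 f d ->
  {for t, continuous f}.
Proof. by move=> [df _]; exact/differentiable_continuous/derivable1_diffP. Qed.

(** An integrable majorant with an explicit primitive, which gives both integrability and the limit
    at infinity. *)
Lemma powR_expR_le p : 0 <= p -> exists2 K : R, 0 <= K &
  forall t, 0 <= t -> t `^ p * expR (- t) <= K * expR (- (t / 2)).
Proof.
move=> p0; pose n := Num.Def.archi_bound p.
have pn : p <= n.+1%:R.
  by apply/ltW/(lt_trans (archi_boundP p0)); rewrite ltr_nat.
have f0 : (0 : R) < n.+1`!%:R by rewrite ltr0n fact_gt0.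
(* The summand 1 covers t <= 1; the other one comes from (t / 2)^(n + 1) / (n + 1)! <= e^(t / 2). *)
pose K : R := 1 + 2 ^+ n.+1 * n.+1`!%:R.
have K1 : 1 <= K by rewrite lerDl mulr_ge0 ?exprn_ge0// ltW.
have HK t : 0 <= t -> t `^ p <= K * expR (t / 2).
  move=> t0; have e1 : 1 <= expR (t / 2).
    by rewrite -expR0 ler_expR divr_ge0.
  have [t1|t1] := leP t 1.
    apply: (@le_trans _ _ (1 `^ p)); last by rewrite powR1 -[leLHS]mulr1 ler_pM.
    by apply: ge0_ler_powR; rewrite ?nnegrE.
  apply: le_trans (ler_powR (ltW t1) pn) _; rewrite powR_mulrn//.
  have t20 : 0 <= t / 2 by rewrite divr_ge0.
  have := expR_ge1Dxn n t20; rewrite exprMn exprVn => h.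
  have {}h : t ^+ n.+1 / 2 ^+ n.+1 / n.+1`!%:R <= expR (t / 2) by lra.
  rewrite !ler_pdivrMr ?exprn_gt0// in h; apply: le_trans h _.
  rewrite (_ : _ * _ * _ = 2 ^+ n.+1 * n.+1`!%:R * expR (t / 2)); last by ring.
  by rewrite ler_wpM2r ?expR_ge0// /K lerDr.
exists K; first exact: le_trans ler01 K1.
move=> t t0; rewrite {1}(_ : - t = - (t / 2) - t / 2); last by field.
rewrite expRD mulrA ler_wpM2r ?expR_ge0//.
by rewrite expRN ler_pdivrMr ?expR_gt0// HK.
Qed.

Lemma is_derive_expRN_half t :
  is_derive t 1 (fun x : R => expR (- (x / 2))) (- (expR (- (t / 2)) / 2)).
Proof.
have d1 : is_derive t 1 (fun x : R => - (x / 2)) (- 2^-1).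
  by apply: is_derive_eq; rewrite !scaler0 add0r [_%:A]mulr1.
have := @is_derive1_comp R expR (fun x => - (x / 2)) t _ _ (is_derive_expR _) d1.
by move=> d; apply: (is_derive_eq d); rewrite mulrN.
Qed.

Lemma is_derive_powR_expRN p t : 0 < t ->
  is_derive t 1 (fun x : R => x `^ p * expR (- x))
    (p * (t `^ (p - 1) * expR (- t)) - t `^ p * expR (- t)).
Proof.
move=> t0.
have d1 : is_derive t 1 (fun x : R => - x) (-1 : R) by apply: is_derive_eq.
have d2 := @is_derive1_comp R expR (fun x => - x) t _ _ (is_derive_expR _) d1.
have d3 := is_deriveM (is_derive1_powR p t0) d2.
by apply: (is_derive_eq d3); rewrite /GRing.scale/=; ring.
Qed.

Lemma expRN_half_cvg : expR (- (x / 2)) @[x --> +oo] --> (0 : R).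
Proof.
apply: (@cvg_comp _ _ _ (fun x : R => x / 2) (fun y => expR (- y)) _ (+oo : set_system R)).
  by apply: gt0_cvgMly => //; exact: cvg_id.
exact: cvgr_expR.
Qed.

Lemma powR_cvg_at_right p : 0 < p -> x `^ p @[x --> (0 : R)^'+] --> (0 `^ p : R).
Proof. by move=> p0; rewrite powR0 ?lt0r_neq0//; exact: powR_cvg0. Qed.

Lemma measurable_powR_expRN p (D : set (measurableTypeR R)) :
  measurable_fun D (fun x : R => x `^ p * expR (- x)).
Proof.
apply: measurable_funTS; apply: measurable_funM; first exact: measurable_powR.
by apply: measurableT_comp; [exact: measurable_expR|exact: oppr_measurable].
Qed.

Lemma measurable_expRN_half (D : set (measurableTypeR R)) :
  measurable_fun D (fun x : R => expR (- (x / 2))).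
Proof.
apply: measurable_funTS; apply: measurableT_comp; first exact: measurable_expR.
by apply: measurableT_comp; [exact: oppr_measurable|exact: measurable_funM].
Qed.

Lemma integral_expRN_half :
  (\int[leb]_(x in `]0%R, +oo[) (expR (- (x / 2)))%:E = 2%:E)%E.
Proof.
rewrite integral_itv_obnd_cbnd; last by apply/measurable_EFinP; exact: measurable_expRN_half.
have dF (t : R) : is_derive t 1 (fun x : R => - 2 * expR (- (x / 2))) (expR (- (t / 2))).
  have d := is_derive_expRN_half t.
  by apply: is_derive_eq; rewrite /GRing.scale/=; field.
have cE (t : R) : {for t, continuous (fun x : R => expR (- (x / 2)))}.
  exact: is_derive1_continuous (is_derive_expRN_half t).
rewrite (@ge0_continuous_FTC2y _ _ (fun x => - 2 * expR (- (x / 2))) 0 0).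
- by rewrite mul0r oppr0 expR0 mulr1 -EFinB opprK add0r.
- by move=> x _; exact: expR_ge0.
- by apply: continuous_subspaceT => x; exact: cE.
- by rewrite -[X in _ --> X](mulr0 (-2)); apply: cvgZr; exact: expRN_half_cvg.
- by move=> x _; have [] := dF x.
- by apply: cvg_at_right_filter; exact: is_derive1_continuous (dF 0).
- by move=> x _; rewrite derive1E; have d := dF x; rewrite derive_val.
Qed.

Lemma integrable_expRN_half :
  leb.-integrable `]0%R, +oo[ (EFin \o (fun x : R => expR (- (x / 2)))).
Proof.
apply/integrableP; split; first by apply/measurable_EFinP; exact: measurable_expRN_half.
under eq_integral => x _ do rewrite /= ger0_norm ?expR_ge0//.
by rewrite integral_expRN_half ltry.
Qed.

Lemma integrable_powR_expRN p : 0 <= p ->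
  leb.-integrable `]0%R, +oo[ (EFin \o (fun x : R => x `^ p * expR (- x))).
Proof.
move=> /powR_expR_le[K K0 HK].
apply: (@le_integrable _ _ _ leb _ _ _ (fun x => K%:E * (expR (- (x / 2)))%:E)%E) => //.
- by apply/measurable_EFinP; exact: measurable_powR_expRN.
- move=> x /=; rewrite in_itv/= andbT => x0.
  rewrite lee_fin !ger0_norm ?mulr_ge0 ?powR_ge0 ?expR_ge0//.
  by rewrite HK// ltW.
- by apply: integrableZl => //; exact: integrable_expRN_half.
Qed.

(* Integrate the derivative of [- t^p e^(-t)]; subtracting a multiple of
   [e^(-t/2)] makes that derivative nonnegative, as the fundamental theorem of
   calculus on [ [0, +oo[ ] requires. *)
Lemma Gamma_rec p : 1 < p -> Gamma (p + 1) = p * Gamma p.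
Proof.
move=> p1; have p0 : 0 < p by rewrite (lt_trans ltr01).
have p10 : 0 < p - 1 by rewrite subr_gt0.
have [K K0 HK] := powR_expR_le (ltW p10).
have [K' K'0 HK'] := powR_expR_le (ltW p0).
rewrite /Gamma addrK.
pose g q := fun x : R => x `^ q * expR (- x).
pose h := fun x : R => expR (- (x / 2)).
pose f x := g p x - p * g (p - 1) x + p * K * h x.
pose F x := - g p x - 2 * p * K * h x.
have dF (t : R) : 0 < t -> is_derive t 1 F (f t).
  move=> t0; have d1 := is_derive_powR_expRN p t0.
  have d2 := is_derive_expRN_half t.
  have d3 := is_deriveB (is_deriveN d1) (is_deriveZ (2 * p * K) d2).
  by apply: (is_derive_eq d3); rewrite /f /g /h /GRing.scale/=; field.
(* Used for q = p and for q = p - 1; the latter is where the strict inequality 1 < p enters. *)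
have cg q : 0 < q -> g q x @[x --> (0 : R)^'+] --> g q 0.
  move=> q0; apply: cvgM; first exact: powR_cvg_at_right.
  apply: cvg_at_right_filter; apply: (@cvg_comp _ _ _ (fun x : R => - x) expR).
    by apply: cvgN; exact: cvg_id.
  exact: continuous_expR.
have ch (t : R) : {for t, continuous h}.
  exact: is_derive1_continuous (is_derive_expRN_half t).
have If : (\int[leb]_(x in `]0%R, +oo[) (f x)%:E = (2 * p * K)%:E)%E.
  rewrite integral_itv_obnd_cbnd; last first.
    apply/measurable_EFinP/measurable_funD; last first.
      by apply: measurable_funM => //; exact: measurable_expRN_half.
    apply: measurable_funB; first exact: measurable_powR_expRN.
    by apply: measurable_funM => //; exact: measurable_powR_expRN.
  rewrite (@ge0_continuous_FTC2y _ _ F 0 0).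
  - by rewrite -EFinB /F /g /h powR0 ?lt0r_neq0// mul0r mul0r !oppr0 expR0 mulr1 !sub0r opprK.
  - move=> x x0; rewrite /f -addrA addr_ge0 ?mulr_ge0 ?powR_ge0 ?expR_ge0//.
    by rewrite addrC subr_ge0 -mulrA ler_wpM2l ?(ltW p0)// HK.
  - apply/continuous_within_itvcyP; split.
      move=> x; rewrite in_itv/= andbT => x0.
      have c q : {for x, continuous (g q)}.
        exact: is_derive1_continuous (is_derive_powR_expRN q x0).
      by apply: cvgD; [apply: cvgB; [exact: c|apply: cvgZr; exact: c]|apply: cvgZr; exact: ch].
    apply: cvgD; first by apply: cvgB; [exact: cg|apply: cvgZr; exact: cg].
    by apply: cvgZr; apply: cvg_at_right_filter; exact: ch.
  - rewrite -[X in _ --> X](subrr (0 : R)); apply: cvgB; last first.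
      by rewrite -[X in _ --> X](mulr0 (2 * p * K)); apply: cvgZr; exact: expRN_half_cvg.
    rewrite -[X in _ --> X]oppr0; apply: cvgN.
    apply: (@squeeze_cvgr _ _ _ _ (fun=> 0) (fun x => K' * h x)).
    + near=> x; rewrite /g mulr_ge0 ?powR_ge0 ?expR_ge0//=; apply: HK'.
      by near: x; apply: nbhs_pinfty_ge; rewrite num_real.
    + exact: cvg_cst.
    + by rewrite -[X in _ --> X](mulr0 K'); apply: cvgZr; exact: expRN_half_cvg.
  - by move=> x x0; have [] := dF x x0.
  - apply: cvgB; first by apply: cvgN; exact: cg.
    by apply: cvgZr; apply: cvg_at_right_filter; exact: ch.
  - move=> x; rewrite in_itv/= andbT => x0.
    by rewrite derive1E; have d := dF x x0; rewrite derive_val.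
have ig q : 0 <= q -> leb.-integrable `]0%R, +oo[ (EFin \o g q).
  exact: integrable_powR_expRN.
have igZ q (c : R) : 0 <= q -> leb.-integrable `]0%R, +oo[ (EFin \o (fun x => c * g q x)).
  by move=> q0; apply: (integrableZl _ _ (ig q q0)).
have ihZ (c : R) : leb.-integrable `]0%R, +oo[ (EFin \o (fun x => c * h x)).
  exact: (integrableZl _ _ integrable_expRN_half).
have : \int[leb]_(x in `]0%R, +oo[) (f x) = 2 * p * K by rewrite /Rintegral If.
rewrite /f RintegralD//; last first.
  exact: (integrableB _ (ig _ (ltW p0)) (igZ _ p (ltW p10))).
rewrite RintegralB// ?ig ?igZ ?(ltW p0) ?(ltW p10)//.
rewrite !RintegralZl// ?ig ?(ltW p0) ?(ltW p10)//; last exact: integrable_expRN_half.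
rewrite [X in _ + p * K * X]/Rintegral integral_expRN_half /=.
rewrite /g => E; apply/eqP; rewrite -subr_eq0; apply/eqP.
by apply: (addIr (p * K * 2)); rewrite E; ring.
Unshelve. all: by end_near. Qed.

(** On [1, 2] the integrand is at least e^-2, because p >= 1. *)
Lemma Gamma_gt0 p : 1 <= p -> 0 < Gamma p.
Proof.
move=> p1; have p10 : 0 <= p - 1 by rewrite subr_ge0.
have ig := integrable_powR_expRN p10.
rewrite /Gamma /Rintegral fine_gt0//; apply/andP; split; last first.
  by rewrite -ge0_fin_numE ?integrable_fin_num//; apply: integral_ge0 => x _;
    rewrite lee_fin mulr_ge0 ?powR_ge0 ?expR_ge0.
apply: (@lt_le_trans _ _ (\int[leb]_(x in `[1%R, 2%R]) (expR (-2))%:E)%E).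
  rewrite integral_cst//= lebesgue_measure_itv/= lte_fin ltr1n -EFinB -EFinM lte_fin.
  by rewrite mulr_gt0 ?expR_gt0//; lra.
apply: (@le_trans _ _ (\int[leb]_(x in `[1%R, 2%R]) (x `^ (p - 1) * expR (- x))%:E)%E).
  apply: ge0_le_integral => //.
  - by apply/measurable_EFinP; exact: measurable_powR_expRN.
  - move=> x /=; rewrite in_itv/= => /andP[x1 x2]; rewrite lee_fin.
    rewrite -[leLHS]mul1r; apply: ler_pM => //; rewrite ?expR_ge0//.
      by have := ler_powR x1 p10; rewrite powRr0.
    by rewrite ler_expR lerN2.
apply: ge0_subset_integral => //.
- by apply/measurable_EFinP; exact: measurable_powR_expRN.
- by move=> x _; rewrite lee_fin mulr_ge0 ?powR_ge0 ?expR_ge0.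
- by move=> x /=; rewrite !in_itv/= andbT => /andP[+ _]; exact: lt_le_trans.
Qed.

Lemma neg_binom_Gamma p n : 1 < p ->
  Gamma (n%:R + p) / (n`!%:R * Gamma p) = neg_binom p n.
Proof.
move=> p1; have G0 : Gamma p != 0 by rewrite lt0r_neq0// Gamma_gt0// ltW.
elim: n => [|n IH].
  by rewrite add0r fact0 mul1r neg_binom0 divff.
have -> : n.+1%:R + p = n%:R + p + 1 by rewrite -natr1 addrAC.
rewrite Gamma_rec; last by rewrite ltr_wpDl.
rewrite neg_binomS -IH factS natrM.
have f0 : (n`!%:R : R) != 0 by rewrite pnatr_eq0 -lt0n fact_gt0.
have n0 : (n.+1%:R : R) != 0 by rewrite pnatr_eq0.
move: G0 (Gamma (n%:R + p)) => + y; move: (Gamma p) => x x0.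
by field; rewrite x0 f0 addrC natr1 n0.
Qed.

End gamma_function.

(** * Bloch functions *)

Section bloch_coefficients.
Context {R : realType}.
Implicit Types (f : R[i] -> R[i]) (a c : nat -> R[i]) (b E B r t : R) (z w : R[i]).

Lemma discE z : disc z = (cmod z < 1) :> Prop.
Proof. by []. Qed.

Lemma disc0 : @disc R 0.
Proof. by rewrite discE Normc.normc0. Qed.

Lemma disc_real t : 0 <= t < 1 -> disc t%:C.
Proof. by move=> /andP[t0 t1]; rewrite discE cmod_real ger0_norm. Qed.

Lemma bloch_seminorm_ge b f z : disc z ->
  (((1 - cmod z ^+ 2) `^ b * cmod (derive1 f z))%:E <= bloch_seminorm b f)%E.
Proof. by move=> z1; apply: ereal_sup_ubound; exists z. Qed.

Lemma bloch_seminorm_ge0 b f : (0 <= bloch_seminorm b f)%E.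
Proof.
apply: le_trans (bloch_seminorm_ge b f disc0).
by rewrite lee_fin mulr_ge0 ?powR_ge0 ?cmod_ge0.
Qed.

Lemma bloch_norm_ge0 b f : (0 <= bloch_norm b f)%E.
Proof. by rewrite /bloch_norm adde_ge0 ?bloch_seminorm_ge0// lee_fin cmod_ge0. Qed.

Lemma neg_binom_series_cvg b r : 0 < b -> 0 <= r < 1 ->
  cvgn (series (fun n => neg_binom b n * r ^+ n)).
Proof.
move=> b0 r01; have /andP[r0 r1] := r01.
apply: nondecreasing_is_cvgn.
  apply: nondecreasing_series => n _ _.
  by rewrite mulr_ge0 ?exprn_ge0// ltW// neg_binom_gt0.
have p0 : 0 < (1 - r) `^ b by rewrite powR_gt0// subr_gt0.
exists ((1 - r) `^ b)^-1 => _ [N _ <-].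
rewrite -[leRHS]mul1r ler_pdivlMr// /series /= big_mkord.
exact: sum_neg_binom_le.
Qed.

Lemma power_series_of_coef b E c : 0 < b ->
  (forall n, cmod (c n) <= E * neg_binom b n) ->
  power_series_at (fun z => limn (series (fun n => c n * z ^+ n))) 0 1 c.
Proof.
move=> b0 cE; apply/power_series_at0P => z z1.
have r01 : 0 <= cmod z < 1 by rewrite cmod_ge0.
have /cvg_ex[/= T cT] := neg_binom_series_cvg b0 r01.
have [|l cl] := @cseries_cvg R (fun n => c n * z ^+ n) _ _ (cvgP _ (@cvg_seriesZ _ E _ _ cT)).
  move=> n; rewrite Normc.normcM cmodX mulrA ler_wpM2r// exprn_ge0// cmod_ge0//.
by apply/cvg_ex; exists l.
Qed.

(** The derivative is dominated coefficientwise by E (1 - z)^-b, so |f'(z)| <= E (1 - |z|)^-b. The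
    factor 2^b comes from 1 - |z|^2 <= 2 (1 - |z|). *)
Lemma derive1_coef_le b E c f z : 0 < b -> power_series_at f 0 1 c ->
  (forall n, n.+1%:R * cmod (c n.+1) <= E * neg_binom b n) -> disc z ->
  (1 - cmod z ^+ 2) `^ b * cmod (derive1 f z) <= E * 2 `^ b.
Proof.
move=> b0 fc cE z1; rewrite discE in z1.
have r01 : 0 <= cmod z < 1 by rewrite cmod_ge0.
have E0 : 0 <= E.
  have := cE 0%N; rewrite neg_binom0 mulr1 mul1r; apply: le_trans; exact: cmod_ge0.
have p0 : 0 < (1 - cmod z) `^ b by rewrite powR_gt0// subr_gt0.
have H : cmod (derive1 f z) <= E / (1 - cmod z) `^ b.
  have /cvg_ex[/= T cT] := neg_binom_series_cvg b0 r01.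
  have TE : E * T <= E / (1 - cmod z) `^ b.
    rewrite ler_wpM2l// -[leRHS]mul1r ler_pdivlMr//.
    have cT' : series (fun n => neg_binom b n * cmod z ^+ n) n * (1 - cmod z) `^ b
        @[n --> \oo] --> T * (1 - cmod z) `^ b by exact: cvgZl.
    have c1 : (1 : R) @[_ --> \oo] --> (1 : R) by exact: cvg_cst.
    apply: (ler_cvg_to cT' c1); near=> N.
    by rewrite /series /= big_mkord; exact: sum_neg_binom_le.
  apply: le_trans TE.
  apply: (cseries_le _ (power_series_derive1 fc z1) (@cvg_seriesZ _ E _ _ cT)) => n.
  rewrite !Normc.normcM cmod_nat cmodX mulrA (mulrC (cmod _) n.+1%:R).
  by rewrite ler_wpM2r// exprn_ge0// cmod_ge0.
have -> : 1 - cmod z ^+ 2 = (1 - cmod z) * (1 + cmod z) by ring.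
have /andP[r0 r1] := r01.
rewrite powRM ?subr_ge0 ?(ltW r1) ?addr_ge0// -mulrA mulrCA.
apply: (@le_trans _ _ ((1 + cmod z) `^ b * E)).
  rewrite ler_wpM2l ?powR_ge0//; move: H; rewrite ler_pdivlMr//.
  by rewrite mulrC.
rewrite mulrC ler_wpM2l//; apply: ge0_ler_powR; rewrite ?nnegrE ?addr_ge0// ?ltW//.
by rewrite -[2]/(1 + 1) ltrD2l.
Unshelve. all: by end_near. Qed.

Lemma bloch_seminorm_le b E c f : 0 < b -> power_series_at f 0 1 c ->
  (forall n, n.+1%:R * cmod (c n.+1) <= E * neg_binom b n) ->
  (bloch_seminorm b f <= (E * 2 `^ b)%:E)%E.
Proof.
move=> b0 fc cE; apply: ge_ereal_sup => _ [z z1 <-].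
by rewrite lee_fin; exact: derive1_coef_le fc cE z1.
Qed.

Lemma bloch_of_coef b E c f : 0 < b -> power_series_at f 0 1 c ->
  (forall n, n.+1%:R * cmod (c n.+1) <= E * neg_binom b n) -> bloch b f.
Proof.
move=> b0 fc cE; split; first exact: power_series_analytic fc.
exact: le_lt_trans (bloch_seminorm_le b0 fc cE) (ltry _).
Qed.

(** The complex difference quotient is taken along real increments, so that growth on [0, 1) becomes
    real calculus in one variable. *)
Lemma is_derive_Re f (t : R) w : derivable f t%:C 1 ->
  is_derive t 1 (fun x : R => Re (w * f x%:C)) (Re (w * derive1 f t%:C)).
Proof.
move=> df; have H : h^-1 *: (Re (w * f (h *: 1 + t)%:C) - Re (w * f t%:C))
    @[h --> (0 : R)^'] --> Re (w * derive1 f t%:C).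
  have c0 : (h^-1 *: (f (h *: 1 + t%:C) - f t%:C) @[h --> (0 : R[i])^'] --> derive1 f t%:C).
    by rewrite derive1E; exact: df.
  have c1 : h%:C @[h --> (0 : R)^'] --> (0 : R[i])^'.
    move=> A /nbhs_ballP[[e e'] /= e0 eA].
    have [e'0 {}e0] : e' = 0 /\ 0 < e by move: e0; rewrite ltcE /= => /andP[/eqP -> ->].
    apply/nbhs_ballP; exists e => //= h; rewrite /ball/= sub0r normrN => he h0.
    apply: eA; last by apply: contra_neq h0 => /complexI.
    by rewrite /ball/= sub0r normrN cmodE cmod_real e'0 ltcR.
  have c2 := cvg_comp _ _ c1 c0.
  have c3 : Re (w * ((fun h : R[i] => h^-1 *: (f (h *: 1 + t%:C) - f t%:C)) \o
      (fun h : R => h%:C)) h) @[h --> (0 : R)^'] --> Re (w * derive1 f t%:C).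
    by apply: cvg_Re; exact: cvgZr.
  apply: cvg_trans c3; apply: near_eq_cvg; near=> h => /=.
  rewrite [h%:C *: 1]mulr1 [h *: 1]mulr1 -rmorphD.
  rewrite -[h%:C^-1]fmorphV [(h^-1)%:C *: _]mulrC mulrA Re_mulr mulrBr.
  by rewrite ReD ReN mulrC.
apply: DeriveDef; first by apply/cvg_ex; exists (Re (w * derive1 f t%:C)).
by apply/cvg_lim => //; exact: norm_hausdorff.
Unshelve. all: by end_near. Qed.

Definition log_weight t : R := 1 - ln (1 - t).

Lemma log_weightE t : t < 1 -> ln (expR 1 / (1 - t)) = log_weight t.
Proof. by move=> t1; rewrite ln_div ?posrE ?expR_gt0 ?subr_gt0// expRK. Qed.

Lemma log_weight0 : log_weight 0 = 1.
Proof. by rewrite /log_weight subr0 ln1 subr0. Qed.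

Lemma log_weight_ge1 t : 0 <= t -> 1 <= log_weight t.
Proof. by move=> t0; rewrite lerDl oppr_ge0 ln_le0// gerBl. Qed.

Lemma is_derive_log_weight t : t < 1 -> is_derive t 1 log_weight (1 - t)^-1.
Proof.
move=> t1; have t1' : 0 < 1 - t by rewrite subr_gt0.
have d1 : is_derive t 1 (fun x : R => 1 - x) (-1 : R).
  by apply: is_derive_eq; rewrite add0r mul1r.
have d2 := @is_derive1_comp R (@ln R) (fun x => 1 - x) t _ _ (is_derive1_ln t1') d1.
have d3 := is_deriveB (is_derive_cst (1 : R) t 1) d2.
by apply: (is_derive_eq d3); rewrite mulrN1 sub0r opprK.
Qed.

(** B L(t) - Re (w f(t)) is nonnegative at 0 and nondecreasing, because |f'(x)| <= B / (1 - x^2) <=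
    B / (1 - x) and L has derivative 1 / (1 - x). The factor w lets one choose the phase later. *)
Lemma bloch_growth f B w t : analytic_on_disc f -> cmod (f 0) <= B ->
  (forall z, disc z -> (1 - cmod z ^+ 2) * cmod (derive1 f z) <= B) ->
  cmod w <= 1 -> 0 <= t < 1 -> Re (w * f t%:C) <= B * log_weight t.
Proof.
move=> fan f0 fB w1 /andP[t0 t1].
have dsc (x : R) : 0 <= x -> x < 1 -> disc x%:C.
  by move=> x0 x1; apply: disc_real; rewrite x0.
have Bw z : cmod z <= B -> Re (w * z) <= B.
  move=> zB; apply: le_trans (ler_norm _) _; apply: le_trans (normr_Re _) _.
  rewrite Normc.normcM; apply: le_trans zB.
  by rewrite -[leRHS]mul1r ler_wpM2r// cmod_ge0.
have B0 : 0 <= B by apply: le_trans f0; exact: cmod_ge0.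
pose G x := B * log_weight x - Re (w * f x%:C).
have dG (x : R) : 0 <= x -> x < 1 -> is_derive x 1 G (B * (1 - x)^-1 - Re (w * derive1 f x%:C)).
  move=> x0 x1; have d1 := is_deriveZ B (is_derive_log_weight x1).
  have d2 := is_derive_Re w (analytic_derivable fan (dsc x x0 x1)).
  exact: is_deriveB d1 d2.
rewrite -subr_ge0 -/(G t).
apply: (@le_trans _ _ (G 0)).
  by rewrite /G log_weight0 mulr1 subr_ge0 Bw.
suff : {in `[0, t]%R &, {homo G : x y / x <= y}}.
  by apply; rewrite ?in_itv/= ?lexx ?t0.
apply: ger0_derive1_le_cc.
- by move=> x; rewrite in_itv/= => /andP[x0 xt]; have [] := dG x (ltW x0) (lt_trans xt t1).
- move=> x; rewrite in_itv/= => /andP[x0 xt].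
  have x1 := lt_trans xt t1.
  have d := dG x (ltW x0) x1; rewrite derive1E derive_val subr_ge0.
  apply: le_trans (ler_norm _) _; apply: le_trans (normr_Re _) _.
  have x10 : 0 < 1 - x by rewrite subr_gt0.
  rewrite ler_pdivlMr//.
  apply: le_trans (fB _ (dsc x (ltW x0) x1)).
  rewrite cmod_real ger0_norm ?(ltW x0)//.
  rewrite Normc.normcM mulrC; apply: ler_pM; rewrite ?mulr_ge0 ?cmod_ge0 ?(ltW x10)//.
    by rewrite lerD2l lerN2 expr2 ger_pMl// (ltW x1).
  by rewrite -[leRHS]mul1r ler_wpM2r// cmod_ge0.
- apply: derivable_within_continuous => x; rewrite in_itv/= => /andP[x0 xt].
  by have [] := dG x x0 (le_lt_trans xt t1).
Qed.

(** This is (1 + 1 / k)^k <= e. It serves for the radius in Cauchy's estimate and for the points N /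
    (N + 1) of the necessity part. *)
Lemma expR1_pow_ge1 k : 1 <= expR 1 * (k%:R / k.+1%:R) ^+ k :> R.
Proof.
case: k => [|k]; first by rewrite expr0 mulr1 -expR0 ler_expR.
have kk : 0 < k.+1%:R :> R by rewrite ltr0n.
have y0 : 0 < 1 + k.+1%:R^-1 :> R by rewrite addr_gt0// invr_gt0.
have -> : k.+1%:R / k.+2%:R = (1 + k.+1%:R^-1)^-1 :> R.
  rewrite -[k.+2%:R]natr1 -[X in _ / X](mulfVK (lt0r_neq0 kk)).
  by rewrite mulrDl divff ?lt0r_neq0// mul1r invfM mulrCA divff ?mulr1 ?lt0r_neq0.
rewrite exprVn ler_pdivlMr ?exprn_gt0// mul1r.
have -> : expR 1 = expR (k.+1%:R * k.+1%:R^-1) :> R by rewrite divff// lt0r_neq0.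
by rewrite expRM_natl lerXn2r ?nnegrE ?expR_ge0 ?(ltW y0)// expR_ge1Dx.
Qed.

(* Cauchy's estimate for [f'] on the circle of radius [k / (k + 1)]. *)
Lemma bloch_coef_bounded f a B : power_series_at f 0 1 a ->
  (forall z, disc z -> (1 - cmod z ^+ 2) * cmod (derive1 f z) <= B) ->
  forall k, cmod (a k.+1) <= B * expR 1.
Proof.
move=> fa fB k.
have fa' : power_series_at (derive1 f) 0 1 (fun n => a n.+1 * n.+1%:R).
  by apply/power_series_at0P => z z1; exact: power_series_derive1.
have B0 : 0 <= B.
  apply: le_trans (fB 0 disc0); rewrite Normc.normc0 expr0n subr0 mul1r.
  exact: cmod_ge0.
have k1 : 0 < k.+1%:R :> R by rewrite ltr0n.
pose r : R := k%:R / k.+1%:R.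
have r1E : 1 - r = k.+1%:R^-1.
  by rewrite /r -[X in X - _](divff (lt0r_neq0 k1)) -mulrBl -natrB// subSnn mul1r.
have r0 : 0 <= r by rewrite divr_ge0.
have r1 : r < 1 by rewrite -subr_gt0 r1E invr_gt0.
(* At this radius the Bloch weight loses a factor k + 1, which the coefficient (k + 1) a_(k+1) of f'
   gives back. *)
have H z : cmod z = r -> cmod (derive1 f z) <= B * k.+1%:R.
  move=> zr; have := fB z; rewrite discE zr => /(_ r1) h.
  have r2 : k.+1%:R^-1 <= 1 - r ^+ 2.
    by rewrite -r1E lerD2l lerN2 expr2 ler_piMl// ltW.
  rewrite -ler_pdivrMr// mulrC; apply: le_trans h; rewrite ler_wpM2r//.
  exact: cmod_ge0.
have r01 : 0 <= r < 1 by rewrite r0.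
have := cauchy_estimate k fa' r01 H.
rewrite Normc.normcM cmod_nat mulrAC ler_pM2r// => h.
have ek : 1 <= expR 1 * r ^+ k by exact: expR1_pow_ge1.
apply: (@le_trans _ _ (cmod (a k.+1) * (expR 1 * r ^+ k))).
  by rewrite -[leLHS]mulr1 ler_wpM2l// cmod_ge0.
by rewrite mulrCA [leLHS]mulrC ler_wpM2r// expR_ge0.
Qed.


End bloch_coefficients.

(** * Carleson measures and moments *)

Section carleson.
Context {R : realType}.
Implicit Types (t s d : R).
Notation leb := (@lebesgue_measure R).
Context (mu : {measure set (measurableTypeR R) -> \bar R}).

Lemma is_derive_exprn n t : is_derive t 1 (fun x : R => x ^+ n) (n%:R * t ^+ n.-1).
Proof.
have -> : (fun x : R => x ^+ n) = horner 'X^n by apply/funext => x; rewrite hornerXn.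
apply: DeriveDef; first exact: derivable_horner.
by rewrite -derive1E -derivE derivXn hornerMn hornerXn mulr_natl.
Qed.

Definition log_weight_pow n t : R := t ^+ n * log_weight t.

(* [(1 - t) `^ (-1)] is [(1 - t)^-1] for [t < 1], in a form that is measurable
   on the whole line. *)
Definition dlog_weight_pow n t : R :=
  n%:R * t ^+ n.-1 * log_weight t + t ^+ n * (1 - t) `^ (-1).

Lemma is_derive_log_weight_pow n t : t < 1 ->
  is_derive t 1 (log_weight_pow n) (dlog_weight_pow n t).
Proof.
move=> t1; have d1 := is_derive_log_weight t1.
have d3 := is_deriveM (is_derive_exprn n t) d1.
apply: (is_derive_eq d3); rewrite /dlog_weight_pow powR_inv1 ?subr_ge0 ?(ltW t1)//.
by rewrite /GRing.scale/= addrC (mulrC (log_weight t)).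
Qed.

Lemma continuous_dlog_weight_pow n t : t < 1 -> {for t, continuous (dlog_weight_pow n)}.
Proof.
move=> t1; apply: cvgD; apply: cvgM.
- by apply: cvgM; [exact: cvg_cst|exact: exprn_continuous].
- exact: is_derive1_continuous (is_derive_log_weight t1).
- exact: exprn_continuous.
- have t1' : 0 < 1 - t by rewrite subr_gt0.
  have c := is_derive1_continuous (is_derive1_powR (-1) t1').
  apply: (@cvg_comp _ _ _ (fun x : R => 1 - x) (fun x => x `^ (-1)) _ _ _ _ c).
  by apply: cvgB; [exact: cvg_cst|exact: cvg_id].
Qed.

Lemma measurable_log_weight (D : set (measurableTypeR R)) :
  measurable_fun D (@log_weight R).
Proof.
apply: measurable_funTS; apply: measurable_funB => //.
by apply: measurableT_comp; [exact: measurable_ln|exact: measurable_funB].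
Qed.

Lemma measurable_log_weight_pow n (D : set (measurableTypeR R)) :
  measurable_fun D (log_weight_pow n).
Proof. by apply: measurable_funM; [exact: measurable_funX|exact: measurable_log_weight]. Qed.

Lemma measurable_dlog_weight_pow n (D : set (measurableTypeR R)) :
  measurable_fun D (dlog_weight_pow n).
Proof.
apply: measurable_funTS; apply: measurable_funD; apply: measurable_funM => //.
- by apply: measurable_funM => //; exact: measurable_funX.
- exact: measurable_log_weight.
- by apply: (measurableT_comp (measurable_powR (-1))); exact: measurable_funB.
Qed.

Lemma dlog_weight_pow_ge0 n t : 0 <= t -> 0 <= dlog_weight_pow n t.
Proof.
move=> t0; rewrite addr_ge0 ?mulr_ge0 ?powR_ge0 ?exprn_ge0//.
exact: le_trans (log_weight_ge1 t0).
Qed.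

Lemma log_weight_pow_ge0 n t : 0 <= t -> 0 <= log_weight_pow n t.
Proof. by move=> t0; rewrite mulr_ge0 ?exprn_ge0// (le_trans _ (log_weight_ge1 t0)). Qed.

Lemma integral_dlog_weight_pow n t : 0 <= t < 1 ->
  (\int[leb]_(s in `[0%R, t]) (dlog_weight_pow n s)%:E =
   (log_weight_pow n t - 0 ^+ n)%:E)%E.
Proof.
move=> /andP[]; rewrite le_eqVlt => /predU1P[<- _|t0 t1].
  by rewrite set_itv1 integral_set1 /log_weight_pow log_weight0 mulr1 subrr.
rewrite (@continuous_FTC2 _ _ (log_weight_pow n))//.
- by rewrite -EFinB [in X in _ - X]/log_weight_pow log_weight0 mulr1.
- apply/continuous_in_subspaceT => x; rewrite inE/= in_itv/= => /andP[_ xt].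
  exact: continuous_dlog_weight_pow (le_lt_trans xt t1).
- split.
  + move=> x; rewrite in_itv/= => /andP[_ xt].
    by have [] := is_derive_log_weight_pow n (lt_trans xt t1).
  + apply: cvg_at_right_filter.
    exact: is_derive1_continuous (is_derive_log_weight_pow n ltr01).
  + apply: cvg_at_left_filter.
    exact: is_derive1_continuous (is_derive_log_weight_pow n t1).
- move=> x; rewrite in_itv/= => /andP[_ xt].
  by rewrite derive1E; have d := is_derive_log_weight_pow n (lt_trans xt t1); rewrite derive_val.
Qed.

(** Up to the factor d, the integrand is the bound that a Carleson condition with constant d puts on
    (s^n L(s))' mu [s, 1). Integrating the first summand by parts yields 2 s^n (1 - s), hence three
    times the Beta integral of s^n (1 - s); 0^n is the boundary term at 0, present only for n =
    0. *)
Lemma integral_carleson_poly n :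
  (\int[leb]_(s in `[0%R, 1%R])
     (n%:R * s ^+ n.-1 * (1 - s) ^+ 2 + s ^+ n * (1 - s))%:E =
   (3 / (n.+1%:R * n.+2%:R) - 0 ^+ n)%:E)%E.
Proof.
pose F s := s ^+ n * (1 - s) ^+ 2 + 3 * (n.+1%:R^-1 * s ^+ n.+1 - n.+2%:R^-1 * s ^+ n.+2).
pose f s := n%:R * s ^+ n.-1 * (1 - s) ^+ 2 + s ^+ n * (1 - s).
have dX := is_derive_exprn.
have n1 : n.+1%:R != 0 :> R by rewrite pnatr_eq0.
have n2 : n.+2%:R != 0 :> R by rewrite pnatr_eq0.
have dF (x : R) : is_derive x 1 F (f x).
  have d1 : is_derive x 1 (fun x : R => 1 - x) (-1 : R).
    by apply: is_derive_eq; rewrite add0r mul1r.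
  have d2 := @is_derive1_comp R (fun x => x ^+ 2) (fun x => 1 - x) x _ _ (dX 2%N (1 - x)) d1.
  have d3 := is_deriveM (dX n x) d2.
  have d4 := is_deriveZ n.+1%:R^-1 (dX n.+1 x).
  have d5 := is_deriveZ n.+2%:R^-1 (dX n.+2 x).
  have d6 := is_deriveD d3 (is_deriveZ 3 (is_deriveB d4 d5)).
  apply: (is_derive_eq d6); rewrite /f /GRing.scale /= !mulrA !mulVf// !mul1r (exprS x n).
  by ring.
rewrite (@continuous_FTC2 _ f F)//.
- rewrite -EFinB; congr _%:E; rewrite /F.
  have e0 m : (0 : R) ^+ m.+1 = 0 by rewrite expr0n.
  rewrite !e0 !expr1n subr0 expr1n !mulr0 !mulr1 subrr e0 mulr0 subrr mulr0 addr0 add0r.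
  congr (_ - _); move: n1 n2; rewrite -[n.+2%:R]natr1 -natr1 => n1 n2.
  by field; rewrite n1 n2.
- have cX m (x : R) : {for x, continuous (fun x : R => x ^+ m)}.
    exact: is_derive1_continuous (dX m x).
  have c1 (x : R) : {for x, continuous (fun x : R => 1 - x)}.
    by apply: cvgB; [exact: cvg_cst|exact: cvg_id].
  apply: continuous_subspaceT => x; apply: cvgD; apply: cvgM.
  + by apply: cvgM; [exact: cvg_cst|exact: cX].
  + exact: (@cvg_comp _ _ _ (fun x : R => 1 - x) (fun x => x ^+ 2) _ _ _ (c1 x) (cX 2%N _)).
  + exact: cX.
  + exact: c1.
- split.
  + by move=> x _; have [] := dF x.
  + by apply: cvg_at_right_filter; exact: is_derive1_continuous (dF 0).
  + by apply: cvg_at_left_filter; exact: is_derive1_continuous (dF 1).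
- by move=> x _; rewrite derive1E; have d := dF x; rewrite derive_val.
Qed.

(* Layer-cake: [t^n L(t) = 0^n + int_0^t (s^n L(s))' ds] and Tonelli reduce the
   integral to that of [(s^n L(s))' mu (A `&` [s, 1))] over [0, 1). *)
Lemma carleson_integral_le (A : set (measurableTypeR R)) d n :
  measurable A -> A `<=` `[0%R, 1%R[ ->
  (forall t, 0 <= t < 1 ->
    (mu (A `&` `[t, 1%R[) * (log_weight t)%:E <= (d * (1 - t) ^+ 2)%:E)%E) ->
  (\int[mu]_(t in A) (log_weight_pow n t)%:E <= (3 * d / (n.+1%:R * n.+2%:R))%:E)%E.
Proof.
move=> mA A01 Ad.
have muA : (mu A <= d%:E)%E.
  have := Ad 0; rewrite lexx ltr01 log_weight0 mule1 subr0 expr1n mulr1 => /(_ isT).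
  by rewrite setIidl.
have muAoo : (mu A < +oo)%E by exact: le_lt_trans muA (ltry _).
have d0 : 0 <= d by rewrite -lee_fin; exact: le_trans muA.
(* Off A the measure mu is arbitrary; its restriction to A is finite, as Tonelli's theorem requires
   a sigma-finite measure. *)
pose nu : {finite_measure set (measurableTypeR R) -> \bar R} := mfrestr mA muAoo.
have -> : (\int[mu]_(t in A) (log_weight_pow n t)%:E =
    \int[nu]_(t in A) (log_weight_pow n t)%:E)%E.
  by apply: eq_measure_integral => B mB BA; rewrite /nu /= /mfrestr /mrestr setIidl.
(* Points are x = (t, s): t is integrated against nu and s against Lebesgue measure. *)
pose E : set (measurableTypeR R * measurableTypeR R) := [set x | x.2 <= x.1].
pose F (x : measurableTypeR R * measurableTypeR R) : \bar R :=
  (dlog_weight_pow n x.2 * \1_A x.1 * \1_(`[0%R, 1%R[) x.2 * \1_E x)%:E.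
have mIt (s : R) : measurable (A `&` `[s, 1%R[) by exact: measurableI.
have inEE x : (x \in E) = (x.2 <= x.1) by apply/idP/idP; rewrite inE.
have mE : measurable E.
  have := @measurable_fun_ler _ _ _ _ _ _
    (@measurable_snd _ _ (measurableTypeR R) (measurableTypeR R))
    (@measurable_fst _ _ (measurableTypeR R) (measurableTypeR R)).
  by move=> /(_ measurableT [set true] I); rewrite setTI.
have mF : measurable_fun setT F.
  apply/measurable_EFinP; apply: measurable_funM; last exact: measurable_indic.
  apply: measurable_funM.
    apply: measurable_funM.
      by apply: measurableT_comp; [exact: measurable_dlog_weight_pow|exact: measurable_snd].
    by apply: measurableT_comp; [exact: measurable_indic|exact: measurable_fst].
  by apply: measurableT_comp; [exact: measurable_indic|exact: measurable_snd].
have F0 x : (0 <= F x)%E.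
  rewrite lee_fin mulr_ge0// mulrAC mulr_ge0// indicE.
  have [|] := boolP (x.2 \in `[0%R, 1%R[%classic); rewrite ?mulr0//.
  rewrite inE/= in_itv/= => /andP[x0 _].
  by rewrite mulr1 dlog_weight_pow_ge0.
have FE1 t : (\int[leb]_s F (t, s) = (\1_A t * (log_weight_pow n t - 0 ^+ n))%:E)%E.
  have [At|At] := boolP (t \in A); last first.
    rewrite indicE (negbTE At) mul0r integral0_eq// => s _.
    by rewrite /F /= indicE (negbTE At) mulr0 !mul0r.
  have : (`[0%R, 1%R[%classic : set R) t by apply: A01; rewrite -inE.
  rewrite /= in_itv/= => t01.
  rewrite indicE At mul1r -integral_dlog_weight_pow// [RHS]integral_mkcond.
  apply: eq_integral => s _; rewrite patchE /F /= !indicE At mulr1 inEE/=.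
  rewrite !mem_setE !in_itv/=.
  have [s0|s0] := leP 0 s; rewrite ?mulr0 ?mul0r//=.
  have [st|st] := leP s t; rewrite ?mulr0//.
  by rewrite (le_lt_trans st) ?mulr1//; case/andP: t01.
have FE2 s : (\int[nu]_t F (t, s) <=
    ((d * (n%:R * s ^+ n.-1 * (1 - s) ^+ 2 + s ^+ n * (1 - s))) * \1_(`[0%R, 1%R[) s)%:E)%E.
  have [s01|s01] := boolP (s \in `[0%R, 1%R[%classic); last first.
    rewrite indicE (negbTE s01) mulr0 integral0_eq// => t _.
    by rewrite /F /= !indicE (negbTE s01) mulr0 !mul0r.
  rewrite indicE s01 mulr1.
  move: (s01); rewrite inE/= in_itv/= => /andP[s0 s1].
  have -> : (\int[nu]_t F (t, s) =
      \int[nu]_t ((dlog_weight_pow n s)%:E * (\1_(A `&` `[s, 1%R[) t)%:E))%E.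
    apply: eq_integral => t _; rewrite /F /= !indicE s01 mulr1 in_setI inEE/= -EFinM -mulrA.
    congr (_ * _)%:E; have [At|At] := boolP (t \in A); last by rewrite mul0r.
    have : (`[0%R, 1%R[%classic : set R) t by apply: A01; rewrite -inE.
    rewrite /= in_itv/= => /andP[t0 t1].
    by rewrite mul1r mem_setE in_itv/= t1 andbT.
  rewrite ge0_integralZl//; last 2 first.
  - by apply/measurable_EFinP; exact: measurable_indic.
  - by rewrite lee_fin dlog_weight_pow_ge0.
  rewrite integral_indic// setIT /nu /= /mfrestr /mrestr setIAC setIid.
  have := Ad s; rewrite s0 s1 => /(_ isT).
  have fX : mu (A `&` `[s, 1%R[) \is a fin_num.
    rewrite ge0_fin_numE//; apply: (@le_lt_trans _ _ (mu A)) => //.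
    by apply: le_measure; rewrite ?inE//; exact: subIsetl.
  rewrite -(fineK fX) -!EFinM !lee_fin.
  have : 0 <= fine (mu (A `&` `[s, 1%R[)) by exact: fine_ge0.
  move: (fine _) => m m0 mL.
  have L1 := log_weight_ge1 s0.
  have s1' : 0 < 1 - s by rewrite subr_gt0.
  (* The summand of the derivative that contains L uses the hypothesis itself; for s^n / (1 - s)
     this form, weakened by L >= 1, suffices. *)
  have m1 : m <= d * (1 - s) ^+ 2.
    by apply: le_trans mL; rewrite -[leLHS]mulr1 ler_wpM2l.
  rewrite /dlog_weight_pow powR_inv1 ?(ltW s1')// [leLHS]mulrDl [leRHS]mulrDr.
  apply: lerD.
    rewrite [leRHS]mulrCA -[leLHS]mulrA ler_wpM2l ?mulr_ge0 ?exprn_ge0//.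
    by rewrite mulrC.
  rewrite -[leLHS]mulrA [leRHS]mulrCA ler_wpM2l ?exprn_ge0// mulrC ler_pdivrMr//.
  by rewrite -mulrA -expr2.
rewrite (_ : (\int[nu]_(t in A) (log_weight_pow n t)%:E =
  \int[nu]_t (\int[leb]_s F (t, s) + (0 ^+ n * \1_A t)%:E))%E); last first.
  rewrite integral_mkcond; apply: eq_integral => t _; rewrite FE1 patchE indicE.
  by case: ifP => _; rewrite -EFinD ?mulr0 ?mul0r ?addr0// !mulr1 mul1r subrK.
rewrite ge0_integralD//; last 3 first.
- by move=> t _; apply: integral_ge0 => s _.
- exact: measurable_fun_fubini_tonelli_F.
- by apply/measurable_EFinP; apply: measurable_funM => //; exact: measurable_indic.
rewrite (fubini_tonelli F)//.
(* For n = 0 the initial value L(0) = 1 contributes mu A <= d, which makes up for the boundary term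
   - 0^n. *)
have -> : 3 * d / (n.+1%:R * n.+2%:R) =
    d * (3 / (n.+1%:R * n.+2%:R) - 0 ^+ n) + 0 ^+ n * d by ring.
rewrite EFinD; apply: leeD; last first.
  under eq_integral => t _ do rewrite EFinM.
  rewrite ge0_integralZl//; last by apply/measurable_EFinP; exact: measurable_indic.
  rewrite integral_indic// setIT /nu /= /mfrestr /mrestr setIid EFinM.
  by apply: lee_wpmul2l => //; rewrite lee_fin exprn_ge0.
have mp (D : set (measurableTypeR R)) : measurable_fun D
    (fun s : R => n%:R * s ^+ n.-1 * (1 - s) ^+ 2 + s ^+ n * (1 - s)).
  apply: measurable_funD; apply: measurable_funM => //.
  - by apply: measurable_funM => //; exact: measurable_funX.
  - by apply: measurable_funX; exact: measurable_funB.
  - exact: measurable_funB.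
have p0 s : 0 <= s -> s <= 1 -> 0 <= n%:R * s ^+ n.-1 * (1 - s) ^+ 2 + s ^+ n * (1 - s).
  by move=> s0 s1; rewrite addr_ge0 ?mulr_ge0 ?exprn_ge0 ?subr_ge0.
apply: (@le_trans _ _ (\int[leb]_s ((d * (n%:R * s ^+ n.-1 * (1 - s) ^+ 2 +
    s ^+ n * (1 - s))) * \1_(`[0%R, 1%R[) s)%:E)%E).
  apply: ge0_le_integral => //.
  - by move=> s _; apply: integral_ge0 => t _.
  - exact: measurable_fun_fubini_tonelli_G.
  - apply/measurable_EFinP; apply: measurable_funM; last exact: measurable_indic.
    by apply: measurable_funM.
rewrite EFinM -integral_carleson_poly -ge0_integralZl//; last 2 first.
- by apply/measurable_EFinP.
- by move=> s /=; rewrite in_itv/= => /andP[s0 s1]; rewrite lee_fin p0.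
rewrite [leRHS]integral_mkcond; apply: ge0_le_integral => //.
- move=> s _; rewrite indicE mem_setE in_itv/=.
  have [s0|_] := leP 0 s; last by rewrite mulr0.
  have [s1|_] := ltP s 1; last by rewrite mulr0.
  by rewrite mulr1 lee_fin mulr_ge0// p0// ltW.
- apply/measurable_EFinP; apply: measurable_funM; last exact: measurable_indic.
  by apply: measurable_funM.
- apply: (measurable_restrictT _ _).1 => //.
  by apply: emeasurable_funM => //; apply/measurable_EFinP.
- move=> s _; rewrite indicE patchE !mem_setE !in_itv/=.
  have [s0|_] := leP 0 s; last by rewrite mulr0.
  have [s1|s1] := ltP s 1; first by rewrite (ltW s1) mulr1.
  by rewrite mulr0; case: ifP => // s1'; rewrite lee_fin mulr_ge0// p0.
Qed.

End carleson.

Lemma nneseries_EFin (R : realType) (u : nat -> R) (l : R) :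
  series u @ \oo --> l -> (\sum_(0 <= k <oo) (u k)%:E = l%:E)%E.
Proof.
move=> ul; apply/cvg_lim => //.
rewrite (_ : (fun n => _) = EFin \o series u); last first.
  by apply/funext => n /=; rewrite sumEFin.
by apply: cvg_EFin => //; exact: nearW.
Qed.

Lemma nneg_series_le (R : realType) (u : nat -> R) (l : R) K :
  (forall n, 0 <= u n) -> series u @ \oo --> l -> series u K <= l.
Proof.
move=> u0 ul; rewrite -(cvg_lim (@norm_hausdorff _ _) ul).
by apply: nondecreasing_cvgn_le; [apply: nondecreasing_series|exact: cvgP ul].
Qed.

(** * Moments and the exchange of sum and integral *)

Section moments.
Context {R : realType} (mu : {measure set (measurableTypeR R) -> \bar R}).
Implicit Types (t : R) (x : nat -> R).
Notation I01 := (`[0%R, 1%R[%classic : set (measurableTypeR R)).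

Definition moment n : R := \int[mu]_(t in I01) (t ^+ n).

Lemma I01P t : I01 t -> 0 <= t < 1.
Proof. by rewrite /= in_itv. Qed.

Lemma moment_ge0 n : 0 <= moment n.
Proof. by apply: Rintegral_ge0 => t /I01P/andP[t0 _]; rewrite exprn_ge0. Qed.

Context (muoo : (mu I01 < +oo)%E).

Lemma integrable_exprn n : mu.-integrable I01 (EFin \o (fun t => t ^+ n)).
Proof.
apply: (@le_integrable _ _ _ mu _ _ _ (cst 1%E)) => //.
- by apply/measurable_EFinP; exact: measurable_funX.
- move=> t /I01P/andP[t0 t1] /=; rewrite lee_fin normr1 ger0_norm ?exprn_ge0//.
  by rewrite exprn_ile1// ltW.
- apply/integrableP; split; first exact: measurable_cst.
  under eq_integral => t _ do rewrite /= normr1.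
  by rewrite (integral_cst mu (measurable_itv _) 1%E) mul1e.
Qed.

Lemma moment_le m n : (m <= n)%N -> moment n <= moment m.
Proof.
move=> mn; apply: le_Rintegral => //; [exact: integrable_exprn..|].
move=> t /I01P/andP[t0 t1]; apply: ler_wiXn2l => //; exact: ltW.
Qed.

Lemma moment_EFin n : (\int[mu]_(t in I01) (t ^+ n)%:E)%E = (moment n)%:E.
Proof. by rewrite /moment /Rintegral fineK//; exact: integrable_fin_num (integrable_exprn n). Qed.

Lemma hankel_momentE (alpha : R) n k : 1 < alpha ->
  hankel_moment mu alpha n k = (neg_binom alpha n * moment (n + k))%:E.
Proof.
move=> a1; rewrite /hankel_moment neg_binom_Gamma//.
under eq_integral => t _ do rewrite EFinM.
have g0 : 0 <= neg_binom alpha n by rewrite ltW// neg_binom_gt0// (lt_trans ltr01).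
rewrite ge0_integralZl//.
- by rewrite moment_EFin -EFinM.
- by apply/measurable_EFinP; exact: measurable_funX.
- by move=> t /I01P/andP[t0 _]; rewrite lee_fin exprn_ge0.
Qed.

Lemma integral_sum_exprn x n K :
  mu.-integrable I01 (EFin \o (fun t => \sum_(k < K) x k * t ^+ (n + k))) /\
  \int[mu]_(t in I01) (\sum_(k < K) x k * t ^+ (n + k)) =
    \sum_(k < K) x k * moment (n + k).
Proof.
have iZ k : mu.-integrable I01 (EFin \o (fun t => x k * t ^+ (n + k))).
  exact: (integrableZl _ _ (integrable_exprn (n + k))).
elim: K => [|K [iK EK]].
  rewrite big_ord0; under [X in EFin \o X]funext => t do rewrite big_ord0.
  split; first exact: integrable0.
  under eq_Rintegral => t _ do rewrite big_ord0.
  by rewrite /Rintegral integral0.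
under [X in EFin \o X]funext => t do rewrite big_ord_recr/=.
under [X in Rintegral _ _ X = _]funext => t do rewrite big_ord_recr/=.
split; first exact: (integrableD _ iK (iZ K)).
rewrite RintegralD// EK big_ord_recr/= RintegralZl//; exact: integrable_exprn.
Qed.

(** Monotone convergence for the geometric series of 1 / (1 - t). *)
Lemma integrable_inv_onem T : series moment @ \oo --> T ->
  mu.-integrable I01 (EFin \o (fun t => (1 - t) `^ (-1))) /\
  \int[mu]_(t in I01) ((1 - t) `^ (-1)) = T.
Proof.
move=> mT.
have E : (\int[mu]_(t in I01) ((1 - t) `^ (-1))%:E = T%:E)%E.
  transitivity (\int[mu]_(t in I01) (\sum_(0 <= k <oo) (t ^+ k)%:E))%E.
    apply: eq_integral => t; rewrite inE => /I01P/andP[t0 t1]; apply/esym.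
    apply: nneseries_EFin; rewrite powR_inv1 ?subr_ge0 ?(ltW t1)//.
    have t1' : `|t| < 1 by rewrite ger0_norm.
    have := @cvg_geometric_series _ 1 _ t1'; rewrite mul1r.
    by under [X in series X]funext => k do rewrite /geometric/= mul1r.
  rewrite integral_nneseries//.
  - by under eq_eseriesr => k _ do rewrite moment_EFin; exact: nneseries_EFin.
  - by move=> k; apply/measurable_EFinP; exact: measurable_funX.
  - by move=> k t /I01P/andP[t0 _]; rewrite lee_fin exprn_ge0.
split; last by rewrite /Rintegral E.
apply/integrableP; split.
  apply/measurable_EFinP; apply: measurable_funTS.
  by apply: (measurableT_comp (measurable_powR (-1))); exact: measurable_funB.
under eq_integral => t _ do rewrite /= ger0_norm ?powR_ge0//.
by rewrite E ltry.
Qed.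

(* The partial sums are at most [B log_weight t + A t^K / (1 - t)], and the
   integral of the last term tends to [0] because the moments are summable. *)
Lemma moment_series_le x (A B T s : R) n : (forall k, `|x k| <= A) ->
  series moment @ \oo --> T ->
  mu.-integrable I01 (EFin \o log_weight_pow n) ->
  (forall t, 0 <= t < 1 -> exists2 g, series (fun k => x k * t ^+ k) @ \oo --> g &
     g <= B * log_weight t) ->
  series (fun k => x k * moment (n + k)) @ \oo --> s ->
  s <= B * \int[mu]_(t in I01) (log_weight_pow n t).
Proof.
move=> xA mT iL xg xs.
have [iW WE] := integrable_inv_onem mT.
have A0 : 0 <= A by exact: le_trans (xA 0%N).
have cN : B * \int[mu]_(t in I01) (log_weight_pow n t) + A * (T - series moment K)
    @[K --> \oo] --> B * \int[mu]_(t in I01) (log_weight_pow n t) + A * (T - T).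
  apply: cvgD; first exact: cvg_cst.
  by apply: cvgZr; apply: cvgB => //; exact: cvg_cst.
rewrite subrr mulr0 addr0 in cN.
apply: (ler_cvg_to xs cN); near=> K; rewrite /series /= big_mkord.
have [iP <-] := integral_sum_exprn x n K.
have [iS SE] := integral_sum_exprn (fun=> 1) 0 K.
have -> : T - \sum_(0 <= k < K) moment k =
    \int[mu]_(t in I01) ((1 - t) `^ (-1) - \sum_(k < K) 1 * t ^+ (0 + k)).
  rewrite RintegralB// WE SE big_mkord; congr (_ - _).
  by apply: eq_bigr => k _; rewrite mul1r.
have iD : mu.-integrable I01
    (EFin \o (fun t => (1 - t) `^ (-1) - \sum_(k < K) 1 * t ^+ (0 + k))).
  exact: (integrableB _ iW iS).
rewrite -(RintegralZl B _ iL)// -(RintegralZl A _ iD)// -RintegralD//; last 2 first.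
- exact: (integrableZl _ _ iL).
- exact: (integrableZl _ _ iD).
apply: le_Rintegral => //.
  exact: (integrableD _ (integrableZl _ B iL) (integrableZl _ A iD)).
move=> t /I01P t01; have /andP[t0 t1] := t01.
have [g cg gB] := xg t t01.
have t1' : `|t| < 1 by rewrite ger0_norm.
have cgeo := @cvg_geometric_series _ A _ t1'.
have tau : \sum_(k < K) t ^+ k <= (1 - t)^-1.
  have gE k : geometric 1 t k = t ^+ k by rewrite /geometric/= mul1r.
  have := cvg_geometric_series (a := 1) t1'; rewrite mul1r => cg1.
  have -> : \sum_(k < K) t ^+ k = series (geometric 1 t) K.
    by rewrite /series/= big_mkord; apply: eq_bigr => k _; rewrite mul1r.
  by apply: nneg_series_le cg1 => k; rewrite gE exprn_ge0.
(* Since |x_k| <= A, adding A t^k makes all terms nonnegative, so a partial sum is at most the full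
   sum. This bounds the truncation error from above by the tail of the geometric series. *)
have := nneg_series_le K _ (cvg_seriesD cg cgeo).
have H k : 0 <= x k * t ^+ k + geometric A t k.
  rewrite /geometric/= -mulrDl mulr_ge0 ?exprn_ge0//.
  by have := xA k; rewrite ler_norml => /andP[+ _]; lra.
move=> /(_ H); rewrite /series/= big_mkord big_split/= => le1.
have -> : \sum_(k < K) x k * t ^+ (n + k) = t ^+ n * \sum_(k < K) x k * t ^+ k.
  by rewrite mulr_sumr; apply: eq_bigr => k _; rewrite exprD mulrCA.
have -> : \sum_(k < K) 1 * t ^+ (0 + k) = \sum_(k < K) t ^+ k.
  by apply: eq_bigr => k _; rewrite mul1r.
rewrite powR_inv1 ?subr_ge0 ?(ltW t1)//.
have {}le1 : \sum_(k < K) x k * t ^+ k <=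
    B * log_weight t + A * ((1 - t)^-1 - \sum_(k < K) t ^+ k).
  have E : \sum_(i < K) geometric A t i = A * \sum_(k < K) t ^+ k.
    by rewrite mulr_sumr.
  rewrite E in le1; rewrite [A * (_ - _)]mulrBr addrA lerBrDr; apply: le_trans le1 _.
  by rewrite lerD2r.
apply: le_trans (ler_wpM2l (exprn_ge0 n t0) le1) _.
rewrite mulrDr lerD//; first by rewrite /log_weight_pow mulrCA.
by rewrite ler_piMl ?mulr_ge0 ?subr_ge0// exprn_ile1// ltW.
Unshelve. all: by end_near. Qed.

End moments.

(** * Sufficiency *)

Section sufficiency.
Context {R : realType} (mu : {measure set (measurableTypeR R) -> \bar R}).
Implicit Types (f g : R[i] -> R[i]) (t B E d alpha : R) (c : nat -> R[i]).
Notation I01 := (`[0%R, 1%R[%classic : set (measurableTypeR R)).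

Definition log_moment n : R := \int[mu]_(t in I01) (log_weight_pow n t).

Lemma integrable_log_weight_pow n d :
  (\int[mu]_(t in I01) (log_weight_pow n t)%:E <= d%:E)%E ->
  mu.-integrable I01 (EFin \o log_weight_pow n) /\ log_moment n <= d.
Proof.
move=> h; have iL : mu.-integrable I01 (EFin \o log_weight_pow n).
  apply/integrableP; split.
    by apply/measurable_EFinP; exact: measurable_log_weight_pow.
  have -> : (\int[mu]_(t in I01) `|(EFin \o log_weight_pow n) t| =
      \int[mu]_(t in I01) (log_weight_pow n t)%:E)%E.
    apply: eq_integral => t; rewrite inE => /I01P/andP[t0 _].
    by rewrite /= ger0_norm// log_weight_pow_ge0.
  exact: le_lt_trans h (ltry _).
split=> //; rewrite -lee_fin; apply: le_trans h.
by rewrite /log_moment /Rintegral fineK//; exact: integrable_fin_num iL.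
Qed.

Lemma log_moment_ge0 n : 0 <= log_moment n.
Proof. by apply: Rintegral_ge0 => t /I01P/andP[t0 _]; exact: log_weight_pow_ge0. Qed.

Lemma log1_carleson2_finite : log1_carleson2 mu -> (mu I01 < +oo)%E.
Proof.
move=> [C [C0 HC]]; have := HC 0; rewrite lexx ltr01 => /(_ isT).
rewrite log_weightE// log_weight0 mule1 => h.
exact: le_lt_trans h (ltry _).
Qed.

Lemma setI_I01 t : 0 <= t -> I01 `&` `[t, 1%R[%classic = `[t, 1%R[%classic.
Proof.
move=> t0; apply/setIidPr => s /=; rewrite !in_itv/= => /andP[ts ->].
by rewrite (le_trans t0 ts).
Qed.

Lemma log1_carleson2_log_moment : log1_carleson2 mu ->
  exists2 d : R, 0 <= d & forall n, mu.-integrable I01 (EFin \o log_weight_pow n) /\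
    log_moment n <= d / (n.+1%:R * n.+2%:R).
Proof.
move=> [C [C0 HC]]; exists (3 * C) => [|n]; first by rewrite mulr_ge0// ltW.
apply: integrable_log_weight_pow; apply: carleson_integral_le => // t t01.
have /andP[t0 t1] := t01.
by rewrite setI_I01//; have := HC t t01; rewrite log_weightE.
Qed.

Lemma series_inv_telescope : cvgn (series (fun n => (n.+1%:R * n.+2%:R)^-1 : R)).
Proof.
apply: nondecreasing_is_cvgn; first by apply: nondecreasing_series => n _ _.
exists 1 => _ [N _ <-]; suff -> : series (fun n => (n.+1%:R * n.+2%:R)^-1) N
  = 1 - N.+1%:R^-1 :> R by rewrite gerBl.
rewrite /series/=; elim: N => [|N IH]; first by rewrite big_nil invr1 subrr.
rewrite big_nat_recr//= IH.
have n1 : N.+1%:R != 0 :> R by rewrite pnatr_eq0.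
have n2 : N.+2%:R != 0 :> R by rewrite pnatr_eq0.
move: n1 n2; rewrite -[N.+2%:R]natr1 -[N.+1%:R]natr1; move: (N%:R : R) => x n1 n2.
by field; rewrite n1 n2.
Qed.

Lemma moment_series_cvg d : (mu I01 < +oo)%E ->
  (forall n, mu.-integrable I01 (EFin \o log_weight_pow n) /\
    log_moment n <= d / (n.+1%:R * n.+2%:R)) ->
  exists T : R, series (moment mu) @ \oo --> T.
Proof.
move=> muoo H; suff : cvgn (series (moment mu)) by move=> /cvg_ex.
apply: (@series_norm_cvg R _ (fun n => d * (n.+1%:R * n.+2%:R)^-1)) => [n|].
  have [iL] := H n; apply: le_trans.
  rewrite ger0_norm ?moment_ge0//; apply: le_Rintegral => //.
    exact: integrable_exprn.
  move=> t /I01P/andP[t0 _]; rewrite -[leLHS]mulr1 ler_wpM2l ?exprn_ge0//.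
  exact: log_weight_ge1.
by have /cvg_ex[/= l cl] := series_inv_telescope; apply/cvg_ex; exists (d * l);
  exact: cvg_seriesZ.
Qed.

Lemma exists_phase (z : R[i]) : exists2 w, cmod w <= 1 & cmod z = Re (w * z).
Proof.
have [->|z0] := eqVneq z 0.
  by exists 0; rewrite ?Normc.normc0// mul0r.
have cz : 0 < cmod z.
  by rewrite lt0r cmod_ge0 andbT; apply: contraNN z0 => /eqP/Normc.eq0_normc ->.
exists ((cmod z)%:C / z); last by rewrite divfK.
by rewrite Normc.normcM Normc.normcV cmod_real ger0_norm ?(ltW cz)// divff ?(lt0r_neq0 cz).
Qed.

(** The consequence of [bloch_norm 1 f <= B] on which the estimates rest, stated pointwise and in
    real numbers. *)
Definition bloch_bound f B := cmod (f 0) <= B /\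
  forall z, disc z -> (1 - cmod z ^+ 2) * cmod (derive1 f z) <= B.

Lemma bloch_norm_bound f B : (bloch_norm 1 f <= B%:E)%E -> bloch_bound f B.
Proof.
move=> fB; split.
  rewrite -lee_fin; apply: le_trans fB; rewrite /bloch_norm leeDl//.
  exact: bloch_seminorm_ge0.
move=> z z1; rewrite -lee_fin; apply: le_trans fB.
apply: (@le_trans _ _ (bloch_seminorm 1 f)).
  apply: le_trans (bloch_seminorm_ge 1 f z1); rewrite lee_fin powRr1//.
  by rewrite subr_ge0 exprn_ile1 ?cmod_ge0// ltW.
by rewrite /bloch_norm leeDr// lee_fin cmod_ge0.
Qed.

(** S is the integral of t^n f(t). The coefficients are bounded by e B and the moments decrease, so
    the series is dominated by e B times the summable sequence of moments. Multiplying by the phase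
    w of S reduces |S| to a real series, to which [moment_series_le] applies with the growth bound
    for Re (w f). *)
Lemma moment_functional_le f (a : nat -> R[i]) B (T : R) n : (mu I01 < +oo)%E ->
  power_series_at f 0 1 a -> bloch_bound f B ->
  series (moment mu) @ \oo --> T ->
  mu.-integrable I01 (EFin \o log_weight_pow n) ->
  exists2 S : R[i], series (fun k => (moment mu (n + k))%:C * a k) @ \oo --> S &
    cmod S <= B * log_moment n.
Proof.
move=> muoo fa [f0 fB] mT iL.
have aA k : cmod (a k) <= B * expR 1.
  case: k => [|k]; last exact: bloch_coef_bounded fa fB k.
  rewrite -(power_series_center fa ltr01); apply: (le_trans f0).
  rewrite ler_peMr//; last by rewrite -expR0 ler_expR.
  exact: le_trans (cmod_ge0 _) f0.
have B0 : 0 <= B * expR 1 by exact: le_trans (cmod_ge0 _) (aA 0%N).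
have [|S cS] := @cseries_cvg R (fun k => (moment mu (n + k))%:C * a k) _ _
    (cvgP _ (@cvg_seriesZ _ (B * expR 1) _ _ mT)).
  move=> k; rewrite Normc.normcM cmod_real ger0_norm ?moment_ge0// mulrC.
  apply: ler_pM; rewrite ?cmod_ge0 ?moment_ge0//.
  by apply: moment_le => //; exact: leq_addl.
exists S => //; have [w w1 ->] := exists_phase S.
apply: (@moment_series_le _ _ muoo (fun k => Re (w * a k)) (B * expR 1) B T _ n) => //.
- move=> k; apply: le_trans (normr_Re _) _; rewrite Normc.normcM.
  by rewrite -[leRHS]mul1r ler_pM ?cmod_ge0.
- move=> t t01; have /power_series_at0P/(_ t%:C (disc_real t01)) := fa.
  move=> /(@cvg_seriesZ _ w)/cvg_series_Re ct.
  exists (Re (w * f t%:C)); last exact: bloch_growth (power_series_analytic fa) f0 fB w1 t01.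
  rewrite (_ : (fun k => _) = Re \o (fun k => w * (a k * t%:C ^+ k)))//.
  by apply/funext => k /=; rewrite -rmorphXn mulrA Re_mulr.
- rewrite (_ : (fun k => _) = Re \o (fun k => w * ((moment mu (n + k))%:C * a k))).
    exact: cvg_series_Re (@cvg_seriesZ _ w _ _ cS).
  by apply/funext => k /=; rewrite [_%:C * _]mulrC mulrA Re_mulr.
Qed.

(* Cauchy's theorem on the existence of an expansion on the whole disc is not
   needed: where there is none, [taylor_coef f] is [0] by convention. *)
Lemma hankel_coef_le alpha f B d n : 1 < alpha -> (mu I01 < +oo)%E ->
  (forall n, mu.-integrable I01 (EFin \o log_weight_pow n) /\
    log_moment n <= d / (n.+1%:R * n.+2%:R)) -> bloch_bound f B ->
  cvgn (hankel_coef_series mu alpha f n) /\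
  cmod (hankel_coef mu alpha f n) <= B * (neg_binom alpha n * log_moment n).
Proof.
move=> a1 muoo H fB.
have g0 : 0 <= neg_binom alpha n by rewrite ltW// neg_binom_gt0// (lt_trans ltr01).
have B0 : 0 <= B by case: fB => + _; apply: le_trans; exact: cmod_ge0.
suff [l cl lB] : exists2 l : R[i], hankel_coef_series mu alpha f n @ \oo --> l &
    cmod l <= B * (neg_binom alpha n * log_moment n).
  by split; [exact: cvgP cl|rewrite /hankel_coef (cvg_lim _ cl)].
have [[a fa]|nfa] := pselect (exists a, power_series_at f 0 1 a); last first.
  exists 0; last by rewrite Normc.normc0 mulr_ge0// mulr_ge0// log_moment_ge0.
  rewrite /hankel_coef_series taylor_coef_default//.
  rewrite (_ : (fun k => _) = (fun=> 0 : R[i])); last by apply/funext => k; rewrite mulr0.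
  by have := @cvg_series_finite R[i] (fun=> 0) 0 (fun _ _ => erefl); rewrite {2}/series/= big_nil.
have [T mT] := moment_series_cvg muoo H.
have [S cS SB] := moment_functional_le muoo fa fB mT (H n).1.
exists ((neg_binom alpha n)%:C * S).
  rewrite /hankel_coef_series (taylor_coefE fa).
  rewrite (_ : (fun k => _) =
      (fun k => (neg_binom alpha n)%:C * ((moment mu (n + k))%:C * a k))).
    exact: cvg_seriesZ cS.
  by apply/funext => k; rewrite hankel_momentE//= mulrA -rmorphM.
by rewrite Normc.normcM cmod_real ger0_norm// mulrCA ler_wpM2l.
Qed.

(** The order of magnitude of the n-th coefficient of H f under the Carleson condition: g(n) times
    the decay of [log_moment n]. Dividing by it turns coefficients into bounded sequences. *)
Definition hankel_weight (alpha : R) n : R :=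
  neg_binom alpha n / (n.+1%:R * n.+2%:R).

Lemma hankel_weight_gt0 alpha n : 0 < alpha -> 0 < hankel_weight alpha n.
Proof. by move=> a0; rewrite divr_gt0 ?neg_binom_gt0// mulr_gt0// ltr0n. Qed.

Lemma hankel_weight_le alpha n : 0 < alpha -> hankel_weight alpha n <= neg_binom alpha n.
Proof.
move=> a0; rewrite ler_pdivrMr ?mulr_gt0 ?ltr0n// ler_peMr//.
  by rewrite ltW// neg_binom_gt0.
by rewrite -natrM ler1n.
Qed.

(** After multiplication by alpha - 1, [neg_binom_shift] leaves alpha + n <= alpha (n + 3) and alpha
    - 1 + n <= (alpha - 1) (n + 2); the second inequality uses alpha >= 2. *)
Lemma hankel_weightS alpha n : 2 <= alpha ->
  n.+1%:R * hankel_weight alpha n.+1 <= alpha * neg_binom (alpha - 1) n.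
Proof.
move=> a2; have a1 : 0 < alpha - 1 by lra.
have a0 : 0 < alpha by lra.
have g0 := neg_binom_gt0 n a1.
have E := neg_binom_shift (alpha - 1) n; rewrite subrK in E.
have n0 : 0 <= n%:R :> R by [].
have n2 : 0 < n.+2%:R * n.+3%:R :> R by rewrite mulr_gt0// ltr0n.
rewrite /hankel_weight mulrA neg_binomS_mul ler_pdivrMr//.
rewrite -(ler_pM2l a1).
have -> : (alpha - 1) * ((alpha + n%:R) * neg_binom alpha n) =
    (alpha + n%:R) * (alpha - 1 + n%:R) * neg_binom (alpha - 1) n.
  by rewrite mulrCA E mulrA.
have -> : (alpha - 1) * (alpha * neg_binom (alpha - 1) n * (n.+2%:R * n.+3%:R)) =
    ((alpha * n.+3%:R) * ((alpha - 1) * n.+2%:R)) * neg_binom (alpha - 1) n by ring.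
rewrite ler_wpM2r ?(ltW g0)//.
have p1 : 0 <= alpha + n%:R by lra.
have p2 : 0 <= alpha - 1 + n%:R by lra.
apply: ler_pM => //.
  have -> : n.+3%:R = n%:R + 3 :> R by rewrite -natrD addn3.
  nra.
have -> : n.+2%:R = n%:R + 2 :> R by rewrite -natrD addn2.
nra.
Qed.

(** In the constant, 1 accounts for the value at 0 and alpha 2^(alpha - 1) for the seminorm, through
    [hankel_weightS] and [bloch_seminorm_le]. *)
Lemma bloch_norm_weighted alpha E c f : 2 <= alpha -> power_series_at f 0 1 c ->
  (forall n, cmod (c n) <= E * hankel_weight alpha n) ->
  bloch (alpha - 1) f /\
  (bloch_norm (alpha - 1) f <= (E * (1 + alpha * 2 `^ (alpha - 1)))%:E)%E.
Proof.
move=> a2 fc cE; have a1 : 0 < alpha - 1 by lra.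
have a0 : 0 < alpha by lra.
have E0 : 0 <= E.
  by have := le_trans (cmod_ge0 _) (cE 0%N); rewrite pmulr_lge0// hankel_weight_gt0.
have cE' n : n.+1%:R * cmod (c n.+1) <= E * alpha * neg_binom (alpha - 1) n.
  apply: le_trans (_ : n.+1%:R * (E * hankel_weight alpha n.+1) <= _).
    by rewrite ler_wpM2l.
  by rewrite mulrCA -mulrA ler_wpM2l// hankel_weightS.
split; first exact: bloch_of_coef a1 fc cE'.
rewrite mulrDr mulr1 mulrA EFinD; apply: leeD; last exact: bloch_seminorm_le a1 fc cE'.
rewrite lee_fin (power_series_center fc ltr01); apply: le_trans (cE 0%N) _.
by rewrite -[leRHS]mulr1 ler_wpM2l// (le_trans (hankel_weight_le _ a0))// neg_binom0.
Qed.

Lemma power_series_weighted alpha E c : 0 < alpha ->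
  (forall n, cmod (c n) <= E * hankel_weight alpha n) ->
  power_series_at (fun z => limn (series (fun n => c n * z ^+ n))) 0 1 c.
Proof.
move=> a0 cE; have E0 : 0 <= E.
  by have := le_trans (cmod_ge0 _) (cE 0%N); rewrite pmulr_lge0// hankel_weight_gt0.
apply: (power_series_of_coef (E := E) a0) => n; apply: le_trans (cE n) _.
by rewrite ler_wpM2l// hankel_weight_le.
Qed.

Lemma hankel_dom_weighted alpha E f : 1 < alpha -> (mu I01 < +oo)%E ->
  (forall n, cvgn (hankel_coef_series mu alpha f n)) ->
  (forall n, cmod (hankel_coef mu alpha f n) <= E * hankel_weight alpha n) ->
  hankel_dom mu alpha f /\
  power_series_at (hankel mu alpha f) 0 1 (hankel_coef mu alpha f).
Proof.
move=> a1 muoo cf cE; have a0 : 0 < alpha by exact: lt_trans a1.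
have ph := power_series_weighted a0 cE; split => //; split => //.
- by move=> n k; rewrite hankel_momentE.
- by move=> z z1; have /power_series_at0P/(_ z z1)/cvgP := ph.
- exact: power_series_analytic ph.
Qed.

Lemma bloch_fin_bound f : bloch 1 f ->
  exists2 B, bloch_norm 1 f = B%:E & bloch_bound f B.
Proof.
move=> [_ foo].
have ffin : bloch_norm 1 f \is a fin_num.
  rewrite fin_numD /= ge0_fin_numE//; exact: bloch_seminorm_ge0.
exists (fine (bloch_norm 1 f)); first by rewrite fineK.
by apply: bloch_norm_bound; rewrite fineK.
Qed.

Lemma hankel_weight_log_moment alpha f B n x : 0 <= B -> 0 < alpha ->
  log_moment n <= x / (n.+1%:R * n.+2%:R) ->
  cmod (hankel_coef mu alpha f n) <= B * (neg_binom alpha n * log_moment n) ->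
  cmod (hankel_coef mu alpha f n) <= B * x * hankel_weight alpha n.
Proof.
move=> B0 a0 qx h; apply: le_trans h _; rewrite -mulrA ler_wpM2l//.
rewrite /hankel_weight mulrCA ler_wpM2l//.
by rewrite ltW// neg_binom_gt0.
Qed.

Lemma log1_carleson2_bounded alpha : 2 <= alpha -> log1_carleson2 mu ->
  bounded_bloch (hankel_dom mu alpha) (hankel mu alpha) 1 (alpha - 1).
Proof.
move=> a2 lc; have a1 : 1 < alpha by lra.
have a0 : 0 < alpha by lra.
have muoo := log1_carleson2_finite lc.
have [d d0 H] := log1_carleson2_log_moment lc.
have main f B : bloch_bound f B -> hankel_dom mu alpha f /\
    (bloch (alpha - 1) (hankel mu alpha f) /\
    (bloch_norm (alpha - 1) (hankel mu alpha f) <=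
     (B * d * (1 + alpha * 2 `^ (alpha - 1)))%:E)%E).
  move=> fB; have B0 : 0 <= B by case: fB => + _; apply: le_trans; exact: cmod_ge0.
  have cE n := hankel_weight_log_moment B0 a0 (H n).2 (hankel_coef_le n a1 muoo H fB).2.
  have [hd ph] := hankel_dom_weighted a1 muoo (fun n => (hankel_coef_le n a1 muoo H fB).1) cE.
  by split => //; exact: bloch_norm_weighted a2 ph cE.
split.
  by move=> f /bloch_fin_bound[B _ /main[? []]].
exists (d * (1 + alpha * 2 `^ (alpha - 1))) => f /bloch_fin_bound[B -> /main[_ [_]]].
by rewrite -EFinM mulrC mulrA mulrC mulrA [_ * B]mulrC mulrA.
Qed.

End sufficiency.

(** * Extraction of a uniformly convergent subsequence *)

Section extraction.
Context {R : realType}.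

(** By compactness of [-M, M] the image filter has a cluster point, and a cluster point of an
    ultrafilter is a limit. *)
Lemma bounded_ultra_cvg (U : set_system nat) (u : nat -> R) (M : R) : UltraFilter U ->
  (forall j, `|u j| <= M) -> exists l : R, u j @[j --> U] --> l.
Proof.
move=> UU uM; have PU : ProperFilter U by exact: ultra_proper.
have PF : ProperFilter (u j @[j --> U]) by exact: fmap_proper_filter.
have [|l [_ cl]] := @segment_compact R (- M) M _ PF.
  suff : U [set j | (`[- M, M]%classic : set R) (u j)] by [].
  by apply: filterE => j /=; rewrite in_itv/= -ler_norml uM.
exists l; apply/cvgrPdist_lt => e e0.
have [//|UC] := in_ultra_setVsetC [set j | `|l - u j| < e] UU.
have U' : U [set j | (u @` ~` [set j | `|l - u j| < e]) (u j)].
  by apply: filterS UC => j jC; exists j.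
by have [_ [[j jC <-] jb]] := cl _ _ U' (nbhsx_ballx l e e0).
Qed.

(* The pointwise limit along an ultrafilter is uniform, the family being
   dominated by a null sequence. *)
Lemma dominated_extraction (e : nat -> nat -> R[i]) (eps : nat -> R) :
  eps @ \oo --> (0 : R) -> (forall j n, cmod (e j n) <= eps n) ->
  exists (phi : nat -> nat) (d : nat -> R[i]),
    {homo phi : m n / (m < n)%N} /\
    forall m n, cmod (e (phi m) n - d n) <= m.+1%:R^-1.
Proof.
move=> eps0 eE; have [U [UU sU]] := ultraFilterLemma eventually_filter.
have PU : ProperFilter U by exact: ultra_proper.
have lim n : exists l : R[i], e j n @[j --> U] --> l.
  have [j|a ua] := @bounded_ultra_cvg U (fun j => Re (e j n)) (eps n) UU.
    by apply: le_trans (eE j n); exact: normr_Re.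
  have [j|b ub] := @bounded_ultra_cvg U (fun j => Im (e j n)) (eps n) UU.
    by apply: le_trans (eE j n); exact: normr_Im.
  by exists (a +i* b); exact: cvg_ReIm.
have [d dE] := choice lim.
have dle n : cmod (d n) <= eps n.
  apply: (@cvgr_to_le _ U _ _ (fun j => cmod (e j n))); first exact: cvg_cmod.
  by apply: nearW => j.
(* Beyond some N both e j n and d n have modulus at most x / 2; the finitely many n < N are handled
   by intersecting members of U. *)
have unif (x : R) : 0 < x -> U [set j | forall n, cmod (e j n - d n) <= x].
  move=> x0; have x20 : 0 < x / 2 by rewrite divr_gt0.
  have /cvgrPdist_le/(_ _ x20)[N _ HN] := eps0.
  have fin K : U [set j | forall n, (n < K)%N -> cmod (e j n - d n) <= x].
    elim: K => [|K IH]; first by apply: filterE.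
    have := dE K => /cvg_cmodP/cvgrPdist_le/(_ _ x0) UK.
    apply: filterS2 IH UK => j jIH jK n; rewrite ltnS leq_eqVlt => /predU1P[->|/jIH//].
    by move: jK; rewrite sub0r normrN ger0_norm// cmod_ge0.
  apply: filterS (fin N) => j jN n; have [/jN//|Nn] := ltnP n N.
  have := HN n Nn; rewrite sub0r normrN => /(le_trans (ler_norm _)) h.
  apply: le_trans (cmodB _ _) _; have := eE j n; have := dle n; lra.
(* U contains every tail of the natural numbers, so the index can be taken beyond p.2. *)
have ex (p : nat * nat) : exists j, (p.2 <= j)%N /\
    forall n, cmod (e j n - d n) <= p.1.+1%:R^-1.
  have H1 : U [set j | (p.2 <= j)%N] by apply: sU; exact: nbhs_infty_ge.
  have H2 := unif p.1.+1%:R^-1; rewrite invr_gt0 ltr0n in H2.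
  by have [j [j1 j2]] := filter_ex (filterI H1 (H2 isT)); exists j.
have [h hE] := choice ex.
pose phi := fix phi m := if m is m'.+1 then h (m, (phi m').+1) else h (0, 0)%N.
exists phi, d; split.
  by apply: homo_ltn; [exact: ltn_trans|move=> m; exact: (hE (m.+1, (phi m).+1)).1].
by move=> [|m] n; [exact: (hE (0, 0)%N).2|exact: (hE (m.+1, (phi m).+1)).2].
Qed.

End extraction.

(** * The vanishing condition: decay of moments and compactness *)

Section vanishing.
Context {R : realType} (mu : {measure set (measurableTypeR R) -> \bar R}).
Implicit Types (f g : R[i] -> R[i]) (t B E d alpha : R) (c : nat -> R[i]).
Notation I01 := (`[0%R, 1%R[%classic : set (measurableTypeR R)).

Lemma neg_binom3 n : neg_binom 3 n = n.+1%:R * n.+2%:R / 2 :> R.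
Proof.
elim: n => [|n IH]; first by rewrite neg_binom0 mul1r divff.
rewrite neg_binomS IH.
have n1 : n.+1%:R != 0 :> R by rewrite pnatr_eq0.
have -> : n.+3%:R = 3 + n%:R :> R by rewrite -natrD add3n.
by field.
Qed.

(** Up to a factor 2 these are the terms of the convergent expansion of (1 - s)^-3. *)
Lemma cvg_quadratic_geometric (s : R) : 0 <= s < 1 ->
  n.+1%:R * n.+2%:R * s ^+ n @[n --> \oo] --> (0 : R).
Proof.
move=> s01; have c3 := neg_binom_series_cvg (ltr0n R 3) s01.
have := cvg_series_cvg_0 c3 => c0.
rewrite -(mulr0 2); under eq_cvg => n.
  rewrite (_ : _ * _ * _ = 2 * (neg_binom 3 n * s ^+ n)); last first.
    by rewrite neg_binom3; field.
  over.
exact: cvgZr.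
Qed.

Lemma vanishing_log1_carleson2_near d : vanishing_log1_carleson2 mu -> 0 < d ->
  exists2 s, 0 <= s < 1 & forall t, s <= t < 1 ->
    (mu `[t, 1%R[ * (log_weight t)%:E <= (d * (1 - t) ^+ 2)%:E)%E.
Proof.
move=> [_ /fine_cvgP[muf /cvgrPdist_le mu0]] d0.
have [e /= e0 He] := filterI muf (mu0 _ d0).
exists (Num.max 0 (1 - e / 2)) => [|t /andP[]].
  by rewrite le_max lexx/= gt_max ltr01/= ltrBlDr ltrDl divr_gt0.
rewrite ge_max => /andP[t0 te] t1.
have [] := He t _ t1.
  by rewrite /= ger0_norm ?subr_ge0 ?(ltW t1)//; lra.
rewrite log_weightE// sub0r normrN => fin h.
have t1' : 0 < (1 - t) ^+ 2 by rewrite exprn_gt0// subr_gt0.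
have -> : (mu `[t, 1%R[ * (log_weight t)%:E =
    mu `[t, 1%R[ * (log_weight t / (1 - t) ^+ 2)%:E * ((1 - t) ^+ 2)%:E)%E.
  by rewrite -muleA -EFinM divfK// lt0r_neq0.
rewrite [leRHS]EFinM; apply: lee_wpmul2r; first by rewrite lee_fin ltW.
by rewrite -(fineK fin) lee_fin (le_trans (ler_norm _)).
Qed.

Lemma le_log_weight t (s : R) : t <= s -> s < 1 -> log_weight t <= log_weight s.
Proof.
move=> ts s1; rewrite lerD2l lerN2 ler_ln ?posrE ?subr_gt0 ?lerD2l ?lerN2//.
exact: le_lt_trans ts s1.
Qed.

(** Split the integral at s close to 1. On [0, s) it is at most s^n L(s) mu [0, 1), which decays
    geometrically; on [s, 1) the Carleson estimate holds with constant d = x / 4 and contributes 3 d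
    after normalization. *)
Lemma vanishing_log_moment : vanishing_log1_carleson2 mu ->
  n.+1%:R * n.+2%:R * log_moment mu n @[n --> \oo] --> (0 : R).
Proof.
move=> van; have muoo := log1_carleson2_finite van.1.
have [d' _ H] := log1_carleson2_log_moment van.1.
apply/cvgrPdist_le => x x0; pose d := x / 4.
have d0 : 0 < d by rewrite divr_gt0.
have [s s01 Hs] := vanishing_log1_carleson2_near van d0.
have /andP[s0 s1] := s01.
pose K := log_weight s * fine (mu I01).
have mufin : mu I01 \is a fin_num by rewrite ge0_fin_numE.
have qK n : log_moment mu n <= s ^+ n * K + 3 * d / (n.+1%:R * n.+2%:R).
  have [iL _] := H n.
  rewrite -lee_fin /log_moment /Rintegral fineK; last exact: integrable_fin_num iL.
  have -> : I01 = `[0%R, s[ `|` `[s, 1%R[.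
    by rewrite -itv_bndbnd_setU// bnd_simp// ltW.
  rewrite ge0_integral_setU//; last 3 first.
  - by apply/measurable_EFinP; exact: measurable_log_weight_pow.
  - move=> t; rewrite -itv_bndbnd_setU ?bnd_simp ?(ltW s1)// => /I01P/andP[t0 _].
    by rewrite lee_fin log_weight_pow_ge0.
  - apply/disj_setPS => t [] /=; rewrite !in_itv/= => /andP[_ ts] /andP[st _].
    by move: (lt_le_trans ts st); rewrite ltxx.
  rewrite EFinD; apply: leeD.
    apply: (@le_trans _ _ (\int[mu]_(t in `[0%R, s[) (s ^+ n * log_weight s)%:E)%E).
      apply: ge0_le_integral => //.
      - move=> t /=; rewrite in_itv/= => /andP[t0 _].
        by rewrite lee_fin log_weight_pow_ge0.
      - by apply/measurable_EFinP; exact: measurable_log_weight_pow.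
      - move=> t /=; rewrite in_itv/= => /andP[t0 ts]; rewrite lee_fin.
        apply: ler_pM; rewrite ?exprn_ge0 ?(le_trans ler01 (log_weight_ge1 t0))//.
          by rewrite lerXn2r ?nnegrE// ltW.
        by apply: le_log_weight => //; exact: ltW.
    rewrite (integral_cst mu (measurable_itv _) (s ^+ n * log_weight s)%:E).
    have -> : ((s ^+ n * K)%:E = (s ^+ n * log_weight s)%:E * mu I01)%E.
      by rewrite /K mulrA EFinM fineK.
    apply: lee_wpmul2l.
      by rewrite lee_fin mulr_ge0 ?exprn_ge0// (le_trans ler01 (log_weight_ge1 s0)).
    apply: le_measure; rewrite ?inE//=.
    by move=> t /=; rewrite !in_itv/= => /andP[-> ts]; exact: lt_trans ts s1.
  apply: carleson_integral_le => //.
    by move=> t /=; rewrite !in_itv/= => /andP[st ->]; rewrite (le_trans s0 st).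
  move=> t /andP[t0 t1]; have [st|ts] := leP s t.
    have -> : `[s, 1%R[ `&` `[t, 1%R[ = `[t, 1%R[%classic.
      by apply/setIidPr => y /=; rewrite !in_itv/= => /andP[ty ->]; rewrite (le_trans st ty).
    by apply: Hs; rewrite st.
  (* For t < s the condition at t follows from the one at s, since L(t) <= L(s) and (1 - s)^2 <= (1
     - t)^2. *)
  have -> : `[s, 1%R[ `&` `[t, 1%R[ = `[s, 1%R[%classic.
    by apply/setIidPl => y /=; rewrite !in_itv/= => /andP[sy ->]; rewrite (le_trans (ltW ts) sy).
  apply: (@le_trans _ _ (mu `[s, 1%R[ * (log_weight s)%:E)%E).
    by apply: lee_wpmul2l => //; rewrite lee_fin; apply: le_log_weight => //; exact: ltW.
  apply: le_trans (Hs s _) _; first by rewrite lexx.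
  rewrite lee_fin ler_wpM2l ?(ltW d0)// lerXn2r ?nnegrE ?subr_ge0 ?(ltW s1) ?(ltW t1)//.
  by rewrite lerD2l lerN2 ltW.
have K0 : 0 <= K by rewrite mulr_ge0 ?fine_ge0// (le_trans ler01 (log_weight_ge1 s0)).
have cK : K * (n.+1%:R * n.+2%:R * s ^+ n) @[n --> \oo] --> (0 : R).
  by rewrite -(mulr0 K); apply: cvgZr; exact: cvg_quadratic_geometric.
have /cvgrPdist_le/(_ d d0) := cK; apply: filterS => n.
rewrite !sub0r !normrN => h.
have n0 : 0 < n.+1%:R * n.+2%:R :> R by rewrite mulr_gt0// ltr0n.
rewrite ger0_norm; last by rewrite mulr_ge0 ?(ltW n0)// log_moment_ge0.
apply: le_trans (ler_wpM2l (ltW n0) (qK n)) _.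
have {}h := le_trans (ler_norm _) h.
rewrite mulrDr [X in _ + X]mulrCA divff ?lt0r_neq0// mulr1.
have -> : n.+1%:R * n.+2%:R * (s ^+ n * K) = K * (n.+1%:R * n.+2%:R * s ^+ n) by ring.
by rewrite (_ : x = d + 3 * d) ?lerD2r// /d; field.
Qed.

Lemma vanishing_log1_carleson2_compact alpha : 2 <= alpha ->
  vanishing_log1_carleson2 mu ->
  compact_bloch (hankel_dom mu alpha) (hankel mu alpha) 1 (alpha - 1).
Proof.
move=> a2 van; split; first exact: (log1_carleson2_bounded a2 van.1).1.
move=> F Fb [M FM]; have a1 : 1 < alpha by lra.
have a0 : 0 < alpha by lra.
have muoo := log1_carleson2_finite van.1.
have [d d0 H] := log1_carleson2_log_moment van.1.
have FB j : bloch_bound (F j) M by exact: bloch_norm_bound (FM j).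
have M0 : 0 <= M by case: (FB 0%N) => + _; apply: le_trans; exact: cmod_ge0.
pose eps n := M * (n.+1%:R * n.+2%:R * log_moment mu n).
have eps0 : eps @ \oo --> (0 : R).
  by rewrite -(mulr0 M); apply: cvgZr; exact: vanishing_log_moment.
have w0 n := hankel_weight_gt0 n a0.
have n0 n : n.+1%:R * n.+2%:R != 0 :> R by rewrite mulf_neq0// pnatr_eq0.
pose e j n := hankel_coef mu alpha (F j) n / (hankel_weight alpha n)%:C.
have eE j n : cmod (e j n) <= eps n.
  rewrite Normc.normcM Normc.normcV cmod_real gtr0_norm// ler_pdivrMr//.
  apply: le_trans (hankel_coef_le n a1 muoo H (FB j)).2 _.
  rewrite /eps /hankel_weight; move: (n0 n); move: (n.+1%:R * _) => x x0.
  by rewrite [leRHS](_ : _ = M * (neg_binom alpha n * log_moment mu n))//; field.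
have [phi [l [hphi el]]] := dominated_extraction eps0 eE.
pose c n := l n * (hankel_weight alpha n)%:C.
(* Comparing with the first extracted sequence shows that l is bounded, so that c defines a power
   series on the disc. *)
have lM n : cmod (l n) <= M * d + 1.
  rewrite -[l n](subKr (e (phi 0%N) n)); apply: le_trans (cmodB _ _) _; apply: lerD.
    apply: le_trans (eE _ _) _; rewrite ler_wpM2l//.
    by have := (H n).2; rewrite ler_pdivlMr ?mulr_gt0 ?ltr0n// mulrC.
  by have := el 0%N n; rewrite invr1.
have cM n : cmod (c n) <= (M * d + 1) * hankel_weight alpha n.
  by rewrite Normc.normcM cmod_real gtr0_norm// ler_wpM2r// ltW.
have pg := power_series_weighted a0 cM.
set g := (fun z => limn _) in pg.
exists phi, g; split=> //; first exact: (bloch_norm_weighted a2 pg cM).1.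
pose K := 1 + alpha * 2 `^ (alpha - 1).
have bd m : (bloch_norm (alpha - 1) (hankel mu alpha (F (phi m)) \- g)%R <=
    (m.+1%:R^-1 * K)%:E)%E.
  have cE n := hankel_weight_log_moment M0 a0 (H n).2 (hankel_coef_le n a1 muoo H (FB (phi m))).2.
  have [_ ph] := hankel_dom_weighted a1 muoo
    (fun n => (hankel_coef_le n a1 muoo H (FB (phi m))).1) cE.
  have pd : power_series_at (hankel mu alpha (F (phi m)) \- g) 0 1
      (fun n => hankel_coef mu alpha (F (phi m)) n - c n).
    apply/power_series_at0P => z z1; move/power_series_at0P/(_ z z1) : ph => ph.
    move/power_series_at0P/(_ z z1) : pg => pg.
    by under [X in series X]funext => n do rewrite mulrBl; exact: cvg_seriesB ph pg.
  apply: (bloch_norm_weighted a2 pd _).2 => n.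
  have -> : hankel_coef mu alpha (F (phi m)) n - c n =
      (e (phi m) n - l n) * (hankel_weight alpha n)%:C.
    rewrite mulrBl divfK//; apply: contraTneq (w0 n) => /complexI ->.
    by rewrite ltxx.
  by rewrite Normc.normcM cmod_real gtr0_norm// ler_wpM2r// ltW.
apply: (@squeeze_cvge _ _ _ _ (fun=> 0%E) _ (fun m => (m.+1%:R^-1 * K)%:E)).
- by apply: nearW => m; rewrite bd andbT bloch_norm_ge0.
- exact: cvg_cst.
- apply: cvg_EFin; first exact: nearW.
  by rewrite -(mul0r K); apply: cvgZl; exact: cvg_harmonic.
Qed.

End vanishing.

(** * Necessity *)

Section necessity.
Context {R : realType} (mu : {measure set (measurableTypeR R) -> \bar R}).
Implicit Types (f g : R[i] -> R[i]) (t d alpha eps : R).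
Notation I01 := (`[0%R, 1%R[%classic : set (measurableTypeR R)).

(* The coefficients of the partial sums of [- log (1 - z)]. *)
Definition log_coef J k : R := if (0 < k <= J)%N then k%:R^-1 else 0.

(** A polynomial written as a limit, the form for which [power_series_of_coef] yields the
    expansion. *)
Definition log_poly J (z : R[i]) : R[i] :=
  limn (series (fun k => (log_coef J k)%:C * z ^+ k)).

Lemma log_coef_ge0 J k : 0 <= log_coef J k.
Proof. by rewrite /log_coef; case: ifP. Qed.

Lemma log_coef_le1 J k : k%:R * log_coef J k <= 1.
Proof.
rewrite /log_coef; case: ifP; last by rewrite mulr0.
by move=> /andP[k0 _]; rewrite divff// pnatr_eq0 -lt0n.
Qed.

Lemma le_log_coef I J k : (I <= J)%N -> log_coef I k <= log_coef J k.
Proof.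
move=> IJ; rewrite /log_coef; case: ifP => [/andP[-> kI]|_].
  by rewrite (leq_trans kI IJ).
exact: log_coef_ge0.
Qed.

Lemma log_poly_series J : power_series_at (log_poly J) 0 1 (fun k => (log_coef J k)%:C).
Proof.
apply: (@power_series_of_coef _ 1 1) => // k.
rewrite neg_binom1 mulr1 cmod_real ger0_norm ?log_coef_ge0//.
rewrite /log_coef; case: ifP => // /andP[k0 _].
by rewrite invf_le1 ?ler1n ?ltr0n.
Qed.

(** The derivative is dominated coefficientwise by 1 / (1 - z), and the bound is 2^b at b = 1; the
    value at 0 is 0. *)
Lemma log_poly_bloch J : bloch 1 (log_poly J) /\ (bloch_norm 1 (log_poly J) <= 2%:E)%E.
Proof.
have h n : n.+1%:R * cmod (log_coef J n.+1)%:C <= 1 * neg_binom 1 n :> R.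
  by rewrite neg_binom1 mulr1 cmod_real ger0_norm ?log_coef_ge0// log_coef_le1.
split; first exact: (@bloch_of_coef R 1 1 _ _ ltr01 (@log_poly_series J) h).
have := @bloch_seminorm_le R 1 1 _ _ ltr01 (@log_poly_series J) h.
rewrite mul1r powRr1// => hle.
by rewrite /bloch_norm (power_series_center (@log_poly_series J) ltr01) Normc.normc0 add0e.
Qed.

(** The moment with n = k = 0 is mu [0, 1). *)
Lemma hankel_dom_finite alpha f : 1 < alpha -> hankel_dom mu alpha f ->
  (mu I01 < +oo)%E.
Proof.
move=> a1 [/(_ 0%N 0%N) + _ _ _]; rewrite /hankel_moment neg_binom_Gamma//.
rewrite neg_binom0; under eq_integral => t _ do rewrite expr0 mulr1.
rewrite (integral_cst mu (measurable_itv _) 1%E) mul1e => h.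
by rewrite -ge0_fin_numE.
Qed.

Lemma hankel_log_poly_coef alpha J n : 1 < alpha -> (mu I01 < +oo)%E ->
  hankel_coef mu alpha (log_poly J) n =
  (neg_binom alpha n * \sum_(k < J.+1) log_coef J k * moment mu (n + k))%:C.
Proof.
move=> a1 muoo; rewrite /hankel_coef /hankel_coef_series (taylor_coefE (@log_poly_series J)).
apply/cvg_lim; first exact: norm_hausdorff.
have -> : (neg_binom alpha n * \sum_(k < J.+1) log_coef J k * moment mu (n + k))%:C =
  series (fun k => (fine (hankel_moment mu alpha n k))%:C * (log_coef J k)%:C) J.+1.
  rewrite /series/= big_mkord mulr_sumr rmorph_sum; apply: eq_bigr => k _.
  by rewrite hankel_momentE//= -rmorphM/= mulrAC mulrA.
apply: cvg_series_finite => k Jk; rewrite /log_coef [(k <= J)%N]leqNgt Jk andbF.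
by rewrite mulr0.
Qed.

Lemma hankel_log_poly_series alpha J : 1 < alpha ->
  hankel_dom mu alpha (log_poly J) ->
  power_series_at (hankel mu alpha (log_poly J)) 0 1 (hankel_coef mu alpha (log_poly J)).
Proof. by move=> a1 [_ _ h _]; apply/power_series_at0P => z z1; exact: h. Qed.

Lemma moment_ge t n : (mu I01 < +oo)%E -> 0 <= t < 1 ->
  t ^+ n * fine (mu `[t, 1%R[) <= moment mu n.
Proof.
move=> muoo /andP[t0 t1].
have sub : `[t, 1%R[ `<=` I01.
  by move=> s /=; rewrite !in_itv/= => /andP[ts ->]; rewrite (le_trans t0 ts).
have fin : mu `[t, 1%R[ \is a fin_num.
  rewrite ge0_fin_numE//; apply: (@le_lt_trans _ _ (mu I01)) => //.
  by apply: le_measure; rewrite ?inE.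
rewrite -lee_fin -moment_EFin// EFinM fineK//.
rewrite -(integral_cst mu (measurable_itv _) (t ^+ n)%:E).
have me (D : set (measurableTypeR R)) : measurable_fun D (fun s : R => (s ^+ n)%:E).
  by apply/measurable_EFinP; exact: measurable_funX.
apply: (@le_trans _ _ (\int[mu]_(s in `[t, 1%R[) (s ^+ n)%:E)%E).
  apply: ge0_le_integral => //.
  - by move=> s _; rewrite lee_fin exprn_ge0.
  - move=> s /=; rewrite in_itv/= => /andP[ts s1]; rewrite lee_fin.
    by rewrite lerXn2r ?nnegrE ?(le_trans t0 ts).
apply: ge0_subset_integral => //.
by move=> s /I01P/andP[s0 _]; rewrite lee_fin exprn_ge0.
Qed.

(** For I <= N this is the sum of 1 / k over I < k <= N, in the form given by the coefficients of
    F_N - F_I. *)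
Definition harmonic_sum I N : R := \sum_(k < N.+1) (log_coef N k - log_coef I k).

(** All Taylor coefficients of the difference are nonnegative reals and a is real, so discarding
    terms and restricting the moments to [a, 1) only decreases the value. *)
Lemma derive1_hankel_log_poly_ge alpha (a : R) I J N : 1 < alpha ->
  (forall J, hankel_dom mu alpha (log_poly J)) -> (I <= N <= J)%N -> (0 < N)%N ->
  a = N%:R / N.+1%:R ->
  (\sum_(n < N.+1) n%:R * neg_binom alpha n) * harmonic_sum I N *
     (a ^+ (3 * N) * fine (mu `[a, 1%R[)) <=
  cmod (derive1 (hankel mu alpha (log_poly J)) a%:C -
        derive1 (hankel mu alpha (log_poly I)) a%:C).
Proof.
move=> a1 hd /andP[IN NJ] N0 aE.
have muoo := hankel_dom_finite a1 (hd 0%N).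
have a01 : 0 <= a < 1.
  by rewrite aE divr_ge0//= ltr_pdivrMr ?ltr0n// mul1r ltr_nat.
have /andP[a_ge0 a_lt1] := a01.
have ca : cmod a%:C < 1 by exact: disc_real.
have dJ := power_series_derive1 (@hankel_log_poly_series _ J a1 (hd J)) ca.
have dI := power_series_derive1 (@hankel_log_poly_series _ I a1 (hd I)) ca.
have D := cvg_series_Re (cvg_seriesB dJ dI).
apply: le_trans (le_trans (ler_norm _) (normr_Re _)).
pose b n := neg_binom alpha n.+1 * n.+1%:R * a ^+ n *
  \sum_(k < J.+1) (log_coef J k - log_coef I k) * moment mu (n.+1 + k).
have sumI n : \sum_(k < I.+1) log_coef I k * moment mu (n + k) =
    \sum_(k < J.+1) log_coef I k * moment mu (n + k).
  rewrite -(big_mkord xpredT (fun k => log_coef I k * moment mu (n + k))).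
  rewrite -(big_mkord xpredT (fun k => log_coef I k * moment mu (n + k))).
  have IJ : (I.+1 <= J.+1)%N by rewrite ltnS (leq_trans IN).
  rewrite [RHS](big_cat_nat (leq0n _) IJ)/= [X in _ + X]big1_seq ?addr0// => k.
  rewrite mem_index_iota => /andP[_ /andP[Ik _]].
  by rewrite /log_coef [(k <= I)%N]leqNgt Ik andbF mul0r.
pose r n := hankel_coef mu alpha (log_poly J) n.+1 * n.+1%:R * a%:C ^+ n -
   hankel_coef mu alpha (log_poly I) n.+1 * n.+1%:R * a%:C ^+ n.
have bE : b = Re \o r.
  apply/funext => n.
  rewrite /r /= !hankel_log_poly_coef// sumI -(rmorph_nat (real_complex R)) -rmorphXn.
  rewrite -!rmorphM -rmorphB /= /b.
  have -> : \sum_(k < J.+1) (log_coef J k - log_coef I k) * moment mu (n.+1 + k) =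
      \sum_(k < J.+1) log_coef J k * moment mu (n.+1 + k) -
      \sum_(k < J.+1) log_coef I k * moment mu (n.+1 + k).
    by rewrite -sumrB; apply: eq_bigr => k _; rewrite mulrBl.
  by ring.
have DE : series b @ \oo --> Re (derive1 (hankel mu alpha (log_poly J)) a%:C -
        derive1 (hankel mu alpha (log_poly I)) a%:C).
  by rewrite bE; exact: D.
have g0 n : 0 <= neg_binom alpha n by rewrite ltW// neg_binom_gt0// (lt_trans ltr01).
have c0 k : 0 <= log_coef J k - log_coef I k.
  by rewrite subr_ge0 le_log_coef// (leq_trans IN).
have b0 n : 0 <= b n.
  rewrite !mulr_ge0 ?exprn_ge0//; apply: sumr_ge0 => k _.
  by rewrite mulr_ge0// moment_ge0.
apply: le_trans (nneg_series_le N b0 DE).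
rewrite big_ord_recl mul0r add0r /series /= big_mkord mulr_suml mulr_suml.
apply: ler_sum => n _; rewrite /b -!mulrA.
rewrite [leLHS]mulrCA ler_wpM2l//.
rewrite ler_wpM2l//.
apply: (@le_trans _ _ (a ^+ n *
    \sum_(k < N.+1) (log_coef N k - log_coef I k) * moment mu (n.+1 + k))).
  rewrite /harmonic_sum mulr_suml mulr_sumr; apply: ler_sum => k _.
  rewrite [leRHS]mulrCA ler_wpM2l ?subr_ge0 ?le_log_coef//.
  apply: le_trans (ler_wpM2l (exprn_ge0 n a_ge0) (moment_ge (n.+1 + k) muoo a01)).
  rewrite mulrA -exprD ler_wpM2r ?fine_ge0//.
  (* The exponent n + (n + 1 + k) is at most 3 N, since n < N and k <= N. *)
  apply: ler_wiXn2l => //; first exact: ltW.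
  have := ltn_ord n; have := ltn_ord k; lia.
rewrite ler_wpM2l ?exprn_ge0//.
rewrite -(big_mkord xpredT
  (fun k => (log_coef N k - log_coef I k) * moment mu (n.+1 + k))).
rewrite -(big_mkord xpredT
  (fun k => (log_coef J k - log_coef I k) * moment mu (n.+1 + k))).
have NJ' : (N.+1 <= J.+1)%N by [].
rewrite [leRHS](big_cat_nat (leq0n _) NJ')/= -[leLHS]addr0 lerD//.
  by apply: ler_sum => k _; rewrite ler_wpM2r ?moment_ge0// lerD2r le_log_coef.
by apply: sumr_ge0 => k _; rewrite mulr_ge0// moment_ge0.
Qed.

(** Telescoping of ln (k + 2) - ln (k + 1) <= 1 / (k + 1). *)
Lemma harmonic_sum_ge I N : (I <= N)%N ->
  ln (N.+1%:R : R) - ln (I.+1%:R : R) <= harmonic_sum I N.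
Proof.
move=> IN; have -> : harmonic_sum I N = \sum_(I <= k < N) k.+1%:R^-1.
  rewrite /harmonic_sum -(big_mkord xpredT (fun k => log_coef N k - log_coef I k)).
  have IN' : (I.+1 <= N.+1)%N by [].
  rewrite (big_cat_nat (leq0n _) IN')/= [X in X + _]big1_seq ?add0r.
    rewrite big_add1 /=; apply: eq_big_nat => k /andP[Ik kN].
    by rewrite /log_coef !ltn0Sn /= kN ltnNge Ik subr0.
  move=> k; rewrite mem_index_iota /= ltnS => kI.
  by rewrite /log_coef kI (leq_trans kI IN) subrr.
rewrite -(telescope_sumr (fun k => ln (k.+1%:R : R)) IN); apply: ler_sum => k _.
have k1 : 0 < k.+1%:R :> R by rewrite ltr0n.
have k2 : 0 < k.+2%:R :> R by rewrite ltr0n.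
rewrite -ln_div ?posrE// (_ : _ / _ = 1 + k.+1%:R^-1).
  by rewrite le_ln1Dx// (lt_trans (ltrN10 _))// invr_gt0.
by rewrite -[k.+2%:R]natr1 mulrDl divff ?lt0r_neq0// mul1r.
Qed.

(** e^3 compensates a^(3N), and (alpha + 2)^(alpha + 1) is the denominator in [neg_binom_ge] at p =
    alpha + 1. *)
Definition necessity_const alpha : R := expR 1 ^+ 3 * (alpha + 2) `^ (alpha + 1).

Lemma necessity_const_ge0 alpha : 0 <= necessity_const alpha.
Proof. by rewrite mulr_ge0 ?powR_ge0// exprn_ge0// expR_ge0. Qed.

(** The sum of the n g(n) is at least a constant times (N + 1)^(alpha + 1) and the Bloch weight at a
    is at least (N + 1)^-(alpha - 1); their product leaves the square. *)
Lemma measure_harmonic_le alpha (a eps : R) I J N : 2 <= alpha ->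
  (forall J, hankel_dom mu alpha (log_poly J)) -> (I <= N <= J)%N -> (0 < N)%N ->
  a = N%:R / N.+1%:R ->
  (1 - cmod a%:C ^+ 2) `^ (alpha - 1) *
    cmod (derive1 (hankel mu alpha (log_poly J)) a%:C -
          derive1 (hankel mu alpha (log_poly I)) a%:C) <= eps ->
  fine (mu `[a, 1%R[) * harmonic_sum I N * N.+1%:R ^+ 2 <= eps * necessity_const alpha.
Proof.
move=> a2 hd INJ N0 aE heps; have a1 : 1 < alpha by lra.
have n1 : 0 < N.+1%:R :> R by rewrite ltr0n.
have a_ge0 : 0 <= a by rewrite aE divr_ge0.
have oneE : 1 - a = N.+1%:R^-1.
  by rewrite aE -[X in X - _](divff (lt0r_neq0 n1)) -mulrBl -natrB// subSnn mul1r.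
have a_lt1 : a < 1 by rewrite -subr_gt0 oneE invr_gt0.
have h := derive1_hankel_log_poly_ge a1 hd INJ N0 aE.
have H0 : 0 <= harmonic_sum I N.
  by apply: sumr_ge0 => k _; rewrite subr_ge0 le_log_coef//; case/andP: INJ.
have m0 : 0 <= fine (mu `[a, 1%R[) by rewrite fine_ge0.
pose p := alpha + 1.
have p0 : 0 <= p by rewrite /p; lra.
(* The sum equals alpha times [neg_binom (alpha + 2)] at N - 1, and there the numerator in
   [neg_binom_ge] is N + alpha + 1 >= N + 1. *)
have S1 : (N.+1%:R / (alpha + 2)) `^ p <= \sum_(n < N.+1) n%:R * neg_binom alpha n.
  case: N N0 {INJ aE heps h oneE H0 n1} => // N _.
  rewrite sum_neg_binom; last by lra.
  have g := neg_binom_ge N p0; have E : p + 1 = alpha + 2 by rewrite /p; lra.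
  rewrite E in g.
  have b0 : 0 < alpha + 2 by lra.
  have N0 : 0 <= N%:R :> R by [].
  apply: (@le_trans _ _ (neg_binom (alpha + 2) N)); last first.
    by rewrite ler_peMl ?(ltW a1)// ltW// neg_binom_gt0.
  apply: le_trans g; apply: ge0_ler_powR => //; rewrite ?nnegrE ?divr_ge0 ?(ltW b0)//.
    by rewrite /p; lra.
  rewrite ler_pM2r ?invr_gt0// -[N.+2%:R]natr1 -natr1 /p; lra.
have e3 : 1 <= expR 1 ^+ 3 * a ^+ (3 * N).
  rewrite mulnC exprM -exprMn; apply: exprn_ege1; rewrite aE.
  exact: expR1_pow_ge1.
have w : N.+1%:R `^ (- (alpha - 1)) <= (1 - cmod a%:C ^+ 2) `^ (alpha - 1).
  rewrite powRN -powR_inv1 ?powR_ge0// -powRrM mulrC powRrM powR_inv1 ?(ltW n1)//.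
  rewrite -oneE; apply: ge0_ler_powR; rewrite ?nnegrE ?subr_ge0 ?(ltW a_lt1)//; first by lra.
    by rewrite cmod_real ger0_norm// exprn_ile1// ltW.
  by rewrite cmod_real ger0_norm// lerD2l lerN2 expr2 ler_piMl// ltW.
pose S := \sum_(n < N.+1) n%:R * neg_binom alpha n.
have {}heps : N.+1%:R `^ (- (alpha - 1)) * (S * harmonic_sum I N *
     (a ^+ (3 * N) * fine (mu `[a, 1%R[))) <= eps.
  apply: le_trans heps; apply: ler_pM => //; rewrite ?powR_ge0//.
  rewrite !mulr_ge0 ?exprn_ge0//; apply: le_trans S1; exact: powR_ge0.
have b0 : 0 < alpha + 2 by lra.
have bp : 0 < (alpha + 2) `^ p by rewrite powR_gt0.
apply: (@le_trans _ _ (N.+1%:R `^ (- (alpha - 1)) * (S * harmonic_sum I N *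
     (a ^+ (3 * N) * fine (mu `[a, 1%R[))) * necessity_const alpha)); last first.
  by rewrite ler_wpM2r// necessity_const_ge0.
have E : N.+1%:R ^+ 2 = N.+1%:R `^ (- (alpha - 1)) *
    ((N.+1%:R / (alpha + 2)) `^ p * (alpha + 2) `^ p) :> R.
  rewrite -powRM ?divr_ge0 ?(ltW b0) ?(ltW n1)// divfK ?lt0r_neq0//.
  rewrite -powRD ?lt0r_neq0 ?implybT//.
  by rewrite (_ : _ + _ = 2%:R) ?powR_mulrn ?(ltW n1)// /p; ring.
rewrite E /necessity_const -/p.
pose c := fine (mu `[a, 1%R[) * harmonic_sum I N *
  N.+1%:R `^ (- (alpha - 1)) * (alpha + 2) `^ p.
have c0 : 0 <= c by rewrite !mulr_ge0// powR_ge0.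
rewrite [leLHS](_ : _ = c * (N.+1%:R / (alpha + 2)) `^ p * 1); last by rewrite /c; ring.
rewrite [leRHS](_ : _ = c * S * (expR 1 ^+ 3 * a ^+ (3 * N))); last by rewrite /c; ring.
by apply: ler_pM => //; rewrite ?mulr_ge0 ?powR_ge0// ler_wpM2l.
Qed.

End necessity.

(** * From the points N / (N + 1) to the Carleson conditions *)

Section carleson_from_harmonic.
Context {R : realType} (mu : {measure set (measurableTypeR R) -> \bar R}).
Implicit Types (t d alpha eps : R).
Notation I01 := (`[0%R, 1%R[%classic : set (measurableTypeR R)).

Lemma fin_num_tail t : (mu I01 < +oo)%E -> 0 <= t -> mu `[t, 1%R[ \is a fin_num.
Proof.
move=> muoo t0; rewrite ge0_fin_numE//; apply: (@le_lt_trans _ _ (mu I01)) => //.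
by apply: le_measure; rewrite ?inE// -(setI_I01 t0); exact: subIsetl.
Qed.

(** The first hypothesis says 1 + 2 ln (I + 1) <= ln (N + 1), so the harmonic sum is at least (1 +
    ln (N + 1)) / 2, whereas L(t) <= 1 + ln (N + 2) <= 2 + ln (N + 1); the factor 6 is ample. *)
Lemma log_weight_harmonic I N t : expR 1 * I.+1%:R ^+ 2 <= N.+1%:R :> R ->
  (1 - t)^-1 <= N.+2%:R -> t < 1 -> log_weight t <= 6 * harmonic_sum I N.
Proof.
move=> IN tN t1; have t1' : 0 < 1 - t by rewrite subr_gt0.
have n1 : 0 < N.+1%:R :> R by rewrite ltr0n.
have i1 : 0 < I.+1%:R :> R by rewrite ltr0n.
have ln1N : 1 + 2 * ln (I.+1%:R : R) <= ln (N.+1%:R : R).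
  have -> : 1 + 2 * ln (I.+1%:R : R) = ln (expR 1 * I.+1%:R ^+ 2).
    by rewrite lnM ?posrE ?expR_gt0 ?exprn_gt0// expRK lnXn// mulr_natl.
  by rewrite ler_ln ?posrE// mulr_gt0 ?expR_gt0 ?exprn_gt0.
have lnI : 0 <= ln (I.+1%:R : R) by rewrite ln_ge0// ler1n.
have ln2 : ln (N.+2%:R : R) <= ln (N.+1%:R : R) + 1.
  have -> : ln (N.+1%:R : R) + 1 = ln (N.+1%:R * expR 1).
    by rewrite lnM ?posrE ?expR_gt0// expRK.
  rewrite ler_ln ?posrE ?mulr_gt0 ?expR_gt0 ?ltr0n//.
  apply: (@le_trans _ _ (N.+1%:R * 2)).
    by rewrite -natrM ler_nat; lia.
  by rewrite ler_wpM2l//; have := @expR_ge1Dx R 1; rewrite -[1 + 1]/2.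
have leIN : (I <= N)%N.
  rewrite -ltnS -(ler_nat R); apply: le_trans IN.
  have i1' : 1 <= I.+1%:R :> R by rewrite ler1n.
  have e1 : 1 <= expR 1 :> R by rewrite -expR0 ler_expR.
  rewrite expr2 mulrA ler_peMl// (le_trans e1)// ler_peMr ?expR_ge0//.
have := @harmonic_sum_ge R _ _ leIN.
have : - ln (1 - t) <= ln (N.+2%:R : R).
  by rewrite -lnV ?posrE// ler_ln ?posrE ?invr_gt0 ?ltr0n.
rewrite /log_weight; move: ln1N lnI ln2.
move: (harmonic_sum _ _) (ln (1 - t)) (ln N.+1%:R) (ln N.+2%:R) (ln I.+1%:R).
by move=> H x y z w *; lra.
Qed.

(** Each t near 1 is compared with a point a <= t of the form N / (N + 1) for which 1 - a and 1 - t
    are comparable; s is chosen so that N is large enough relative to I. *)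
Lemma harmonic_carleson eps I : (mu I01 < +oo)%E ->
  (forall N, (I <= N)%N -> (0 < N)%N ->
    fine (mu `[(N%:R / N.+1%:R)%R, 1%R[) * harmonic_sum I N * N.+1%:R ^+ 2 <= eps) ->
  exists2 s, 0 <= s < 1 & forall t, s <= t < 1 ->
    (mu `[t, 1%R[ * (log_weight t)%:E <= (24 * eps * (1 - t) ^+ 2)%:E)%E.
Proof.
(* The summand 1 absorbs the rounding of (1 - t)^-1 down to n. *)
move=> muoo H; pose x : R := expR 1 * I.+1%:R ^+ 2 + 1.
have x1 : 1 < x by rewrite ltrDr mulr_gt0 ?expR_gt0// exprn_gt0// ltr0n.
have x0 : 0 < x by exact: lt_trans x1.
have s0 : 0 <= 1 - x^-1 by rewrite subr_ge0 invf_le1// ltW.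
exists (1 - x^-1) => [|t /andP[st t1]].
  by rewrite s0/= gtrBl invr_gt0.
have t1' : 0 < 1 - t by rewrite subr_gt0.
have t0 : 0 <= t by exact: le_trans st.
have xt : x <= (1 - t)^-1.
  by rewrite -[x]invrK lef_pV2 ?posrE ?invr_gt0//; lra.
have yt0 : 0 <= (1 - t)^-1 by rewrite invr_ge0 ltW.
pose n := Num.truncn (1 - t)^-1.
have /andP[nt tn] : n%:R <= (1 - t)^-1 < n.+1%:R by exact: truncn_itv.
have en : expR 1 * I.+1%:R ^+ 2 <= n%:R :> R.
  have := le_lt_trans xt tn; rewrite -[n.+1%:R]natr1 /x ltrD2r; exact: ltW.
have e2 : 2 <= expR 1 * I.+1%:R ^+ 2 :> R.
  have e1 := @expR_ge1Dx R 1.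
  apply: (@le_trans _ _ (expR 1)) => //.
  by rewrite ler_peMr ?expR_ge0// exprn_ege1// ler1n.
have n2 : (2 <= n)%N by rewrite -(ler_nat R) (le_trans e2).
(* Now (1 - t)^-1 lies in [N + 2, N + 3), and the comparison point is (N + 1) / (N + 2) <= t. *)
case: n nt tn en n2 => // -[|N]// nt tn en _.
have lw := log_weight_harmonic en (ltW tn) t1.
have IN : (I <= N.+1)%N.
  rewrite -ltnS -(ler_nat R); apply: le_trans en.
  have i1 : 1 <= I.+1%:R :> R by rewrite ler1n.
  have e1 : 1 <= expR 1 :> R by rewrite -expR0 ler_expR.
  by rewrite expr2 mulrA ler_peMl// (le_trans e1)// ler_peMr ?expR_ge0.
have := H _ IN isT; set a := _ / _ => Ha.
have n0 : 0 < N.+2%:R :> R by rewrite ltr0n.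
have a_ge0 : 0 <= a by rewrite divr_ge0.
have aE : 1 - a = N.+2%:R^-1.
  by rewrite /a -[X in X - _](divff (lt0r_neq0 n0)) -mulrBl -natrB// subSnn mul1r.
have at_ : a <= t.
  have : N.+2%:R^-1 >= 1 - t by rewrite -[leLHS]invrK lef_pV2 ?posrE ?invr_gt0.
  by rewrite -aE lerD2l lerN2.
have ta : (mu `[t, 1%R[ <= mu `[a, 1%R[)%E.
  apply: le_measure; rewrite ?inE// => y /=; rewrite !in_itv/= => /andP[ty ->].
  by rewrite (le_trans at_ ty).
have L0 : 0 <= log_weight t by rewrite (le_trans ler01 (log_weight_ge1 t0)).
apply: le_trans (lee_wpmul2r _ ta) _; first by rewrite lee_fin.
rewrite -(fineK (fin_num_tail muoo a_ge0)) -EFinM lee_fin.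
have m0 : 0 <= fine (mu `[a, 1%R[) by exact: fine_ge0.
move: (fine _) m0 Ha => m m0 Ha.
apply: le_trans (ler_wpM2l m0 lw) _.
have n3 : 0 < N.+3%:R :> R by rewrite ltr0n.
have tn' : N.+3%:R^-1 <= 1 - t by rewrite -[leRHS]invrK lef_pV2 ?posrE ?invr_gt0// ltW.
have eps0 : 0 <= eps.
  apply: le_trans Ha; rewrite !mulr_ge0 ?exprn_ge0//.
  by apply: sumr_ge0 => k _; rewrite subr_ge0 le_log_coef.
apply: (@le_trans _ _ (24 * eps * N.+3%:R ^- 2)); last first.
  by rewrite ler_wpM2l ?mulr_ge0// -exprVn lerXn2r ?nnegrE ?invr_ge0 ?(ltW t1')// ltW.
rewrite ler_pdivlMr ?exprn_gt0//.
(* This 4, times the 6 of [log_weight_harmonic], makes 24. *)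
have n23 : N.+3%:R ^+ 2 <= 4 * N.+2%:R ^+ 2 :> R.
  have : 1 <= N.+2%:R :> R by rewrite ler1n.
  by rewrite -[N.+3%:R]natr1; move: (N.+2%:R : R) => y y1; nra.
have H0 : 0 <= harmonic_sum I N.+1 :> R.
  by apply: sumr_ge0 => k _; rewrite subr_ge0 le_log_coef.
apply: (@le_trans _ _ (m * (6 * harmonic_sum I N.+1) * (4 * N.+2%:R ^+ 2))).
  by rewrite ler_wpM2l// !mulr_ge0.
have -> : m * (6 * harmonic_sum I N.+1) * (4 * N.+2%:R ^+ 2) =
  24 * (m * harmonic_sum I N.+1 * N.+2%:R ^+ 2) by ring.
by rewrite ler_wpM2l.
Qed.

(** For t < s the left-hand side is at most mu [0, 1) L(s), while (1 - t)^2 >= (1 - s)^2; the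
    constant K covers this range. *)
Lemma log1_carleson2_of_near s eps : (mu I01 < +oo)%E -> 0 <= s < 1 -> 0 <= eps ->
  (forall t, s <= t < 1 ->
    (mu `[t, 1%R[ * (log_weight t)%:E <= (eps * (1 - t) ^+ 2)%:E)%E) ->
  log1_carleson2 mu.
Proof.
move=> muoo /andP[s0 s1] e0 H.
pose K := fine (mu I01) * log_weight s / (1 - s) ^+ 2.
have s1' : 0 < 1 - s by rewrite subr_gt0.
have L0 : 0 <= log_weight s by rewrite (le_trans ler01 (log_weight_ge1 s0)).
have K0 : 0 <= K by rewrite !mulr_ge0 ?fine_ge0 ?invr_ge0 ?exprn_ge0 ?(ltW s1').
exists (K + eps + 1); split; first by rewrite ltr_wpDl// addr_ge0.
move=> t /andP[t0 t1]; rewrite log_weightE//.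
have t1' : 0 < 1 - t by rewrite subr_gt0.
have [st|ts] := leP s t.
  apply: le_trans (H t _) _; first by rewrite st.
  by rewrite lee_fin ler_wpM2r ?exprn_ge0 ?(ltW t1')//; lra.
have mufin : mu I01 \is a fin_num by rewrite ge0_fin_numE.
apply: (@le_trans _ _ (mu I01 * (log_weight s)%:E)%E).
  apply: lee_pmul => //.
  - by rewrite lee_fin (le_trans ler01 (log_weight_ge1 t0)).
  - by apply: le_measure; rewrite ?inE// -(setI_I01 t0); exact: subIsetl.
  - by rewrite lee_fin; apply: le_log_weight => //; exact: ltW.
rewrite -(fineK mufin) -EFinM lee_fin.
rewrite -[leLHS](divfK (lt0r_neq0 (exprn_gt0 2 s1'))) -/K.
apply: ler_pM => //; rewrite ?exprn_ge0 ?(ltW s1')//; first by lra.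
by rewrite lerXn2r ?nnegrE ?(ltW s1') ?(ltW t1')// lerD2l lerN2 ltW.
Qed.

Lemma vanishing_of_near : (mu I01 < +oo)%E ->
  (forall eps, 0 < eps -> exists2 s, 0 <= s < 1 & forall t, s <= t < 1 ->
    (mu `[t, 1%R[ * (log_weight t)%:E <= (eps * (1 - t) ^+ 2)%:E)%E) ->
  vanishing_log1_carleson2 mu.
Proof.
move=> muoo H; split.
  by have [s s01 Hs] := H 1 ltr01; exact: log1_carleson2_of_near muoo s01 ler01 Hs.
have near0 : \forall t \near (1 : R)^'-, 0 <= t < 1.
  by near=> t; apply/andP; split; near: t; [exact: nbhs_left_ge|exact: nbhs_left_lt].
have fin t : 0 <= t < 1 -> (mu `[t, 1%R[ * (ln (expR 1 / (1 - t)) / (1 - t) ^+ 2)%:E)%E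
    = (fine (mu `[t, 1%R[%classic) * (log_weight t / (1 - t) ^+ 2))%:E.
  by move=> /andP[t0 t1]; rewrite log_weightE// -{1}(fineK (fin_num_tail muoo t0)).
apply/fine_cvgP; split; first by apply: filterS near0 => t /fin ->.
apply/cvgrPdist_le => eps eps0; have [s /andP[s0 s1] Hs] := H eps eps0.
near=> t; have t01 : 0 <= t < 1 by near: t.
have /andP[t0 t1] := t01.
have st : s <= t by near: t; exact: nbhs_left_ge.
rewrite /= fin//= sub0r normrN.
have t1' : 0 < (1 - t) ^+ 2 by rewrite exprn_gt0// subr_gt0.
have L0 : 0 <= log_weight t by rewrite (le_trans ler01 (log_weight_ge1 t0)).
rewrite ger0_norm ?mulr_ge0 ?fine_ge0// ?invr_ge0 ?(ltW t1')//.
rewrite mulrA ler_pdivrMr//.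
have := Hs t; rewrite st t1 => /(_ isT).
by rewrite -(fineK (fin_num_tail muoo t0)) -EFinM lee_fin.
Unshelve. all: by end_near. Qed.

End carleson_from_harmonic.

(** * The necessity of both Carleson conditions *)

Section main.
Context {R : realType} (mu : {measure set (measurableTypeR R) -> \bar R}).
Implicit Types (alpha : R).
Notation I01 := (`[0%R, 1%R[%classic : set (measurableTypeR R)).

Lemma node_disc N : @disc R (N%:R / N.+1%:R)%:C.
Proof.
by apply: disc_real; rewrite divr_ge0//= ltr_pdivrMr ?ltr0n// mul1r ltr_nat.
Qed.

Lemma bloch_norm_derive1_le b (B : R) f (z : R[i]) : disc z -> (bloch_norm b f <= B%:E)%E ->
  (1 - cmod z ^+ 2) `^ b * cmod (derive1 f z) <= B.
Proof.
move=> z1 fB; rewrite -lee_fin; apply: le_trans fB.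
apply: le_trans (bloch_seminorm_ge b f z1) _.
by rewrite /bloch_norm leeDr// lee_fin cmod_ge0.
Qed.

Lemma bounded_log1_carleson2 alpha : 2 <= alpha ->
  bounded_bloch (hankel_dom mu alpha) (hankel mu alpha) 1 (alpha - 1) ->
  log1_carleson2 mu.
Proof.
move=> a2 [maps [M HM]]; have a1 : 1 < alpha by lra.
have hd J : hankel_dom mu alpha (log_poly J) by exact: (maps _ (log_poly_bloch J).1).1.
have muoo := hankel_dom_finite a1 (hd 0%N).
have nJ J : (bloch_norm (alpha - 1) (hankel mu alpha (log_poly J)) <= (`|M| * 2)%:E)%E.
  apply: le_trans (HM _ (log_poly_bloch J).1) _.
  apply: (@le_trans _ _ (`|M|%:E * bloch_norm 1 (log_poly J))%E).
    by apply: lee_wpmul2r; [exact: bloch_norm_ge0|rewrite lee_fin ler_norm].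
  by rewrite EFinM; apply: lee_wpmul2l (log_poly_bloch J).2; rewrite lee_fin.
have key N : (0 <= N)%N -> (0 < N)%N ->
    fine (mu `[(N%:R / N.+1%:R)%R, 1%R[) * harmonic_sum 0 N * N.+1%:R ^+ 2 <=
    (`|M| * 2 + `|M| * 2) * necessity_const alpha.
  move=> _ N0; apply: (@measure_harmonic_le _ _ _ _ _ 0 N N) => //; first by rewrite leqnn.
  apply: le_trans (ler_wpM2l (powR_ge0 _ _) (cmodB _ _)) _; rewrite mulrDr.
  by apply: lerD; apply: bloch_norm_derive1_le => //; exact: node_disc.
have [s s01 Hs] := harmonic_carleson muoo key.
apply: log1_carleson2_of_near muoo s01 _ Hs.
by rewrite 2?mulr_ge0 ?necessity_const_ge0// addr_ge0// mulr_ge0.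
Qed.

(** The index I = phi n0 is frozen and J = phi n may be arbitrarily large. Both images are within
    eta of g, so their difference has norm at most 2 eta, while for t close enough to 1 the harmonic
    sum from I is still comparable to L(t). *)
Lemma compact_vanishing_log1_carleson2 alpha : 2 <= alpha ->
  compact_bloch (hankel_dom mu alpha) (hankel mu alpha) 1 (alpha - 1) ->
  vanishing_log1_carleson2 mu.
Proof.
move=> a2 [maps cpt]; have a1 : 1 < alpha by lra.
have hd J : hankel_dom mu alpha (log_poly J) by exact: (maps _ (log_poly_bloch J).1).1.
have muoo := hankel_dom_finite a1 (hd 0%N).
have [|phi [g [hphi gb gcv]]] := cpt log_poly (fun J => (log_poly_bloch J).1).
  by exists 2 => J; exact: (log_poly_bloch J).2.
apply: vanishing_of_near => // eps eps0.
(* 24 comes from [harmonic_carleson], 2 from eta + eta, and adding 1 to [necessity_const] makes C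
   positive. *)
pose C := 24 * (2 * (necessity_const alpha + 1)).
have C0 : 0 < C by rewrite !mulr_gt0// ltr_wpDl// necessity_const_ge0.
pose eta := eps / C.
have eta0 : 0 < eta by rewrite divr_gt0.
have /fine_cvgP[gfin /cvgrPdist_le/(_ _ eta0) gle] := gcv.
have [n0 _ Hn0] := filterI gfin gle.
have near_g n : (n0 <= n)%N ->
    (bloch_norm (alpha - 1) (hankel mu alpha (log_poly (phi n)) \- g)%R <= eta%:E)%E.
  move=> /Hn0[nfin]; rewrite /= sub0r normrN => h.
  by rewrite -(fineK nfin) lee_fin (le_trans (ler_norm _) h).
have phin n : (n <= phi n)%N.
  elim: n => // n IH; apply: leq_ltn_trans IH _; exact: hphi.
have key N : (phi n0 <= N)%N -> (0 < N)%N ->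
    fine (mu `[(N%:R / N.+1%:R)%R, 1%R[) * harmonic_sum (phi n0) N * N.+1%:R ^+ 2 <=
    (eta + eta) * necessity_const alpha.
  (* n >= n0 keeps H F_(phi n) close to g, and n >= N ensures N <= phi n. *)
  move=> IN N0; pose n := maxn n0 N.
  have NJ : (N <= phi n)%N by rewrite (leq_trans _ (phin n))// leq_maxr.
  apply: (@measure_harmonic_le _ _ _ _ _ (phi n0) (phi n) N) => //; first by rewrite IN.
  set z := _%:C; have z1 : disc z by exact: node_disc.
  have dg : derivable g z 1 by exact: analytic_derivable gb.1 z1.
  have dT j : derivable (hankel mu alpha (log_poly j)) z 1.
    by apply: analytic_derivable z1; have [_ _ _] := hd j.
  have dE j : derive1 (hankel mu alpha (log_poly j) \- g) z =
      derive1 (hankel mu alpha (log_poly j)) z - derive1 g z.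
    exact: derive1B (dT j) dg.
  have -> : derive1 (hankel mu alpha (log_poly (phi n))) z -
      derive1 (hankel mu alpha (log_poly (phi n0))) z =
      derive1 (hankel mu alpha (log_poly (phi n)) \- g) z -
      derive1 (hankel mu alpha (log_poly (phi n0)) \- g) z.
    by rewrite [X in _ = X - _]dE [X in _ = _ - X]dE opprB addrA subrK.
  apply: le_trans (ler_wpM2l (powR_ge0 _ _) (cmodB _ _)) _; rewrite mulrDr.
  apply: lerD; apply: bloch_norm_derive1_le => //; apply: near_g => //.
  exact: leq_maxl.
have [s s01 Hs] := harmonic_carleson muoo key.
exists s => // t st; apply: le_trans (Hs t st) _; rewrite lee_fin.
rewrite ler_wpM2r ?exprn_ge0//; first by case/andP: st => _ t1; rewrite subr_ge0 ltW.
rewrite -[leRHS](divfK (lt0r_neq0 C0)) -/eta /C.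
rewrite -subr_ge0 (_ : _ - _ = 48 * eta); last by ring.
by rewrite mulr_ge0// ltW.
Qed.

End main.

Theorem theorem3p3 (R : realType) (alpha : R) (halpha : 2 <= alpha)
    (mu : {measure set (measurableTypeR R) -> \bar R}) :
  (bounded_bloch (hankel_dom mu alpha) (hankel mu alpha) 1 (alpha - 1)
     <-> log1_carleson2 mu) /\
  (compact_bloch (hankel_dom mu alpha) (hankel mu alpha) 1 (alpha - 1)
     <-> vanishing_log1_carleson2 mu).
Proof.
split; split.
- exact: bounded_log1_carleson2.
- exact: log1_carleson2_bounded.
- exact: compact_vanishing_log1_carleson2.
- exact: vanishing_log1_carleson2_compact.
Qed.
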